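(* Let $(X,\partial)$ be a differential curve, $V$ a vector bundle on $X$, $(M,\partial_M)$ a $V$-framed micro-oper on $X$, and $U\subset X$ the open subset where $M$ is trivial as a $V$-framed $\mathcal D$-bundle (i.e. canonically identified with $V\otimes\mathcal D$). Then the micro-oper $M|_U$ determines, and is determined by, a $V$-twisted Lax operator over $U$.
   Context: A differential curve $(X,\partial)$ is a curve $X$ (a smooth quasiprojective complex curve, or a Weierstrass cubic: a reduced irreducible complex projective curve of arithmetic genus one with a nonsingular marked point) with a choice of global vector field $\partial$; for a Weierstrass cubic $\partial$ is a nonzero vector field invariant under the group structure on the smooth locus. $\mathcal D$ is the sheaf of differential operators on $X$ (for a cubic curve, the subalgebra generated by $\mathcal O_X$ and $\partial$), filtered by order. $\mathcal E$ is the sheaf of microdifferential operators (microlocalization of $\mathcal D$): locally formal series $\sum_{N\le N_0}a_N\partial^N$ with $\partial^nf=\sum_{i\ge0}\binom nif^{(i)}\partial^{n-i}$, filtered by order ($\mathcal E_k$); $\mathcal E(1)$ is $\mathcal E$ with shifted filtration $\mathcal E(1)_k=\mathcal E_{k+1}$. A $\mathcal D$-bundle is a locally projective coherent right $\mathcal D$-module (isomorphic to $\mathcal D^n$ near the singular locus). A $V$-framed $\mathcal D$-bundle is a $\mathcal D$-bundle $M$ with a $\mathcal D$-module filtration $\{M_k\}$ and an isomorphism $\bigoplus_{k\ge k'}\operatorname{gr}_k(M)\to V\otimes\operatorname{gr}_{\ge k'}(\mathcal D)$ of $\operatorname{gr}(\mathcal D)$-modules for some $k'$ such that (i) near the singular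 point, if any, $M\cong V\otimes\mathcal D$ compatibly with the framing; (ii) the canonical filtration $M\cap M_{\mathcal E,k}$, where $M_{\mathcal E}=M\otimes_{\mathcal D}\mathcal E$ and $M_{\mathcal E,k}=\bigcup_{n\ge0}M_{k+n}\mathcal E_{-n}$, has $k$th term of rank $(k+1)\operatorname{rk}V$ for $k\ge0$ and $0$ for $k<0$. A $V$-framed micro-oper is a $V$-framed $\mathcal D$-bundle $M$ with a right $\mathcal E$-module endomorphism $\partial_M$ of $M_{\mathcal E}$ that has degree $1$ for the induced filtration and induces $\operatorname{gr}(\partial_M)=\mathrm{Id}_V\otimes\partial:\operatorname{gr}_nM_{\mathcal E}\cong V\otimes\operatorname{gr}_n\mathcal E\to V\otimes\operatorname{gr}_{n+1}\mathcal E\cong\operatorname{gr}_{n+1}M_{\mathcal E}$. A $V$-twisted Lax operator over an open set $U\subseteq X$ is a filtration-preserving right $\mathcal E$-module homomorphism $L:V\otimes\mathcal E\to V\otimes\mathcal E(1)$ over $U$ (i.e. $L(V\otimes\mathcal E_k)\subset V\otimes\mathcal E_{k+1}$ for all $k$) with principal symbol $\mathrm{Id}\otimes\partial$. *)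

(* Defs.v *)
From HB Require Import structures.
From mathcomp Require Import all_boot all_order all_algebra.
From mathcomp Require Import boolp classical_sets reals.
From mathcomp Require Import complex mpoly.

Set Implicit Arguments.
Unset Strict Implicit.
Unset Printing Implicit Defensive.

Import GRing.Theory.
Local Open Scope classical_set_scope.
Local Open Scope ring_scope.

(** * Quasi-projective varieties over C = R[i], as point sets in P^n *)

Section Projective.
Variables (R : realType) (n : nat).

(* A point of P^n(C) is stored as its representative whose first nonzero
   homogeneous coordinate is 1. *)
Definition normalized (v : 'rV[R[i]]_n.+1) : bool :=
  [exists i : 'I_n.+1, (v 0 i == 1) &&
    [forall j : 'I_n.+1, (j < i)%N ==> (v 0 j == 0)]].

Definition proj : Type := {v : 'rV[R[i]]_n.+1 | normalized v}.

Definition crd (p : proj) (i : 'I_n.+1) : R[i] := sval p 0 i.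

(* The vanishing of [hev f p], and quotients [hev g p / hev h p] of equal
   degrees, do not depend on the representative when the forms are
   homogeneous. *)
Definition hev (f : {mpoly R[i][n.+1]}) (p : proj) : R[i] := f.@[crd p].

Definition zopen (A : set proj) : Prop :=
  forall p, A p -> exists d, exists g : {mpoly R[i][n.+1]},
    [/\ g \is d.-homog, hev g p != 0 & forall q, hev g q != 0 -> A q].

Definition zclosed (A : set proj) : Prop := zopen (~` A).

Definition quasi_projective (X : set proj) : Prop :=
  exists A B, [/\ zopen A, zclosed B & X = A `&` B].

Record open (X : set proj) : Type := Open {
  oset :> proj -> Prop;
  open_prop : oset `<=` X /\ exists2 A, zopen A & oset = X `&` A }.

Definition irreducible (X : set proj) : Prop :=
  X !=set0 /\
  forall U W : open X, oset U !=set0 -> oset W !=set0 ->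
    oset U `&` oset W !=set0.

(* For an irreducible variety: one-dimensional means infinite, with finite
   proper closed subsets. *)
Definition one_dimensional (X : set proj) : Prop :=
  (~ exists s : seq proj, X `<=` [set p | p \in s]) /\
  forall U : open X, oset U !=set0 ->
    exists s : seq proj, X `\` oset U `<=` [set p | p \in s].

Definition is_curve (X : set proj) : Prop :=
  [/\ quasi_projective X, irreducible X & one_dimensional X].

Definition vanishes (X : set proj) (f : {mpoly R[i][n.+1]}) : Prop :=
  forall p, X p -> hev f p = 0.

(* Jacobian criterion for a curve: the differentials at [p] of the homogeneous
   equations of the curve have rank n - 1. *)
Definition smooth_at (X : set proj) (p : proj) : Prop :=
  exists f : 'I_n.-1 -> {mpoly R[i][n.+1]},
    (forall i, (exists d, f i \is d.-homog) /\ vanishes X (f i)) /\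
    \rank (\matrix_(i < n.-1, j < n.+1) hev (f i)^`M(j) p) = n.-1.

Definition smooth_locus (X : set proj) : set proj :=
  [set p | X p /\ smooth_at X p].

(* The degree-d part of the homogeneous coordinate ring has dimension m. *)
Definition hilbert_function (X : set proj) (d m : nat) : Prop :=
  exists b : 'I_m -> {mpoly R[i][n.+1]},
    (forall i, b i \is d.-homog) /\
    forall f, f \is d.-homog ->
      exists! c : {ffun 'I_m -> R[i]}, vanishes X (f - \sum_i c i *: b i).

(* For a projective curve p_a = 1 - P(0), with P(d) = e d + 1 - p_a the Hilbert
   polynomial. *)
Definition arithmetic_genus (X : set proj) (g : nat) : Prop :=
  exists e d0 : nat, forall d, (d0 <= d)%N ->
    exists2 m, hilbert_function X d m & (m + g)%N = (e * d + 1)%N.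

(* Coordinates on P^n x P^n: the first block is [p], the second is [q]. *)
Definition crd2 (x y : 'I_n.+1 -> R[i]) (k : 'I_(n.+1 + n.+1)) : R[i] :=
  match split k with inl i => x i | inr j => y j end.

Definition bihomogeneous (d e : nat) (f : {mpoly R[i][n.+1 + n.+1]}) : Prop :=
  forall (a b : R[i]) x y,
    f.@[crd2 (fun i => a * x i) (fun i => b * y i)] =
    a ^+ d * b ^+ e * f.@[crd2 x y].

Definition regular_map2 (G : set proj) (m : proj -> proj -> proj) : Prop :=
  forall p q, G p -> G q ->
  exists d e, exists F : 'I_n.+1 -> {mpoly R[i][n.+1 + n.+1]},
    [/\ forall i, bihomogeneous d e (F i),
        exists i, (F i).@[crd2 (crd p) (crd q)] != 0 &
        forall p' q', G p' -> G q' ->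
          (exists i, (F i).@[crd2 (crd p') (crd q')] != 0) ->
          exists2 c, c != 0 &
            forall i, (F i).@[crd2 (crd p') (crd q')] = c * crd (m p' q') i].

(* A commutative algebraic group structure on G with neutral element e. *)
Record algebraic_group (G : set proj) (e : proj)
    (m : proj -> proj -> proj) (inv : proj -> proj) : Prop := {
  ag_e : G e;
  ag_m : forall p q, G p -> G q -> G (m p q);
  ag_inv : forall p, G p -> G (inv p);
  ag_mA : forall p q r, G p -> G q -> G r -> m p (m q r) = m (m p q) r;
  ag_mC : forall p q, G p -> G q -> m p q = m q p;
  ag_me : forall p, G p -> m e p = p;
  ag_minv : forall p, G p -> m (inv p) p = e;
  ag_m_regular : regular_map2 G m;
  ag_inv_regular : regular_map2 G (fun _ p => inv p) }.

End Projective.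

Notation "W `<=o` U" := (oset W `<=` oset U) (at level 70, no associativity).

Section OpenSets.
Variables (R : realType) (n : nat) (X : set (proj R n)).
Implicit Types U W : open X.

Lemma hevM (f g : {mpoly R[i][n.+1]}) (p : proj R n) :
  hev (f * g) p = hev f p * hev g p.
Proof. by rewrite /hev mevalM. Qed.

Lemma zopenI (A B : set (proj R n)) : zopen A -> zopen B -> zopen (A `&` B).
Proof.
move=> oA oB p [Ap Bp].
have [d [g [hg gp gA]]] := oA p Ap; have [e [h [hh hp hB]]] := oB p Bp.
exists (d + e)%N, (g * h); split; first exact: dhomogM.
  by rewrite hevM mulf_neq0.
by move=> q; rewrite hevM mulf_eq0 negb_or => /andP[gq hq]; split; auto.
Qed.

Lemma openT_prop : X `<=` X /\ exists2 A : set (proj R n), zopen A & X = X `&` A.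
Proof.
split=> //; exists setT; last by rewrite setIT.
move=> p _; exists 0%N, 1; split=> //; first exact: dhomog1.
by rewrite /hev meval1 oner_eq0.
Qed.

Definition oT : open X := Open openT_prop.

Lemma openI_prop U W : (oset U `&` oset W `<=` X) /\
  exists2 A : set (proj R n), zopen A & oset U `&` oset W = X `&` A.
Proof.
case: U W => [u [uX [A oA uE]]] [w [wX [B oB wE]]] /=.
split=> [p [/uX]//|]; exists (A `&` B); first exact: zopenI.
by rewrite uE wE setIACA setIid.
Qed.

Definition oI U W : open X := Open (openI_prop U W).

Lemma open_subT U : U `<=o` oT.
Proof. exact: (proj1 (open_prop U)). Qed.

Lemma open_union_prop (P : set (proj R n)) :
  P `<=` X -> (forall p, P p -> exists2 W : open X, W p & oset W `<=` P) ->
  P `<=` X /\ exists2 A : set (proj R n), zopen A & P = X `&` A.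
Proof.
move=> PX oP; split=> //.
exists (\bigcup_(A in [set A | zopen A /\ X `&` A `<=` P]) A).
  move=> p [A [oA AP] Ap]; have [d [g [hg gp gA]]] := oA p Ap.
  by exists d, g; split=> // q gq; exists A => //; apply: gA.
apply/seteqP; split=> [p Pp|p [Xp [A [_ AP] Ap]]]; last exact: AP.
split; first exact: PX.
have [[w [wX [A oA wE]]] /= wp wP] := oP p Pp.
by exists A; [split=> //; rewrite -wE|move: wp; rewrite wE => -[]].
Qed.

End OpenSets.

(** * Sheaves, sheaves of rings, right modules *)

Section Sheaves.
Variables (R : realType) (n : nat) (X : set (proj R n)).
Local Notation open := (open X).

(* Restriction maps are total in the pair of opens; only the values for an
   inclusion matter. *)
Record is_sheaf (F : open -> zmodType) (r : forall U W, F U -> F W) : Prop :=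
  IsSheaf {
  sh_add : forall U W, W `<=o` U ->
    forall s t, r U W (s + t) = r U W s + r U W t;
  sh_id : forall U s, r U U s = s;
  sh_comp : forall U W Z, W `<=o` U -> Z `<=o` W ->
    forall s, r W Z (r U W s) = r U Z s;
  sh_sep : forall U (s t : F U),
    (forall p, U p -> exists W : open, [/\ W p, W `<=o` U & r U W s = r U W t]) ->
    s = t;
  sh_glue : forall U (c : set open) (s : forall W, F W),
    (forall W, c W -> W `<=o` U) ->
    (forall p, U p -> exists2 W, c W & W p) ->
    (forall W W' Z, c W -> c W' -> Z `<=o` W -> Z `<=o` W' ->
      r W Z (s W) = r W' Z (s W')) ->
    exists t : F U, forall W, c W -> r U W t = s W }.

Record rsheaf : Type := RSheaf {
  rsec :> open -> pzRingType;
  rres : forall U W, rsec U -> rsec W;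
  rsheafP : is_sheaf rres;
  rres1 : forall U W, W `<=o` U -> rres W (1 : rsec U) = 1;
  rresM : forall U W, W `<=o` U ->
    forall s t : rsec U, rres W (s * t) = rres W s * rres W t }.

Record rmap (A B : rsheaf) : Type := RMap {
  rmap_fun :> forall U, A U -> B U;
  rmapD : forall U (s t : A U), rmap_fun (s + t) = rmap_fun s + rmap_fun t;
  rmap1 : forall U, rmap_fun (1 : A U) = 1;
  rmapM : forall U (s t : A U), rmap_fun (s * t) = rmap_fun s * rmap_fun t;
  rmap_res : forall U W, W `<=o` U ->
    forall s : A U, rmap_fun (rres W s) = rres W (rmap_fun s) }.

(* Sheaves of right modules. *)
Record rmod (A : rsheaf) : Type := RMod {
  msec :> open -> zmodType;
  mres : forall U W, msec U -> msec W;
  mact : forall U, msec U -> A U -> msec U;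
  rmodP : is_sheaf mres;
  mactDl : forall U (m m' : msec U) a, mact (m + m') a = mact m a + mact m' a;
  mactDr : forall U (m : msec U) a b, mact m (a + b) = mact m a + mact m b;
  mact1 : forall U (m : msec U), mact m 1 = m;
  mactM : forall U (m : msec U) a b, mact m (a * b) = mact (mact m a) b;
  mact_res : forall U W, W `<=o` U -> forall (m : msec U) a,
    mres W (mact m a) = mact (mres W m) (rres W a) }.

Lemma is_sheaf_res0 (F : open -> zmodType) (r : forall U W, F U -> F W) :
  is_sheaf r -> forall U W, W `<=o` U -> r U W 0 = 0.
Proof.
by move=> sr U W WU; apply: (addrI (r U W 0)); rewrite -(sh_add sr)// !addr0.
Qed.

End Sheaves.

Notation "m *a a" := (mact m a) (at level 40, left associativity).

(** * The structure sheaf *)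

Section StructureSheaf.
Variables (R : realType) (n : nat) (X : set (proj R n)).
Local Notation open := (open X).

(* Functions on an open set U are extended by 0 outside U. *)
Definition is_regular (U : open) (f : proj R n -> R[i]) : Prop :=
  (forall p, ~ U p -> f p = 0) /\
  forall p, U p -> exists d, exists g h : {mpoly R[i][n.+1]},
    [/\ g \is d.-homog, h \is d.-homog, hev h p != 0 &
        forall q, U q -> hev h q != 0 -> f q = hev g q / hev h q].

Record regfun (U : open) : Type :=
  RegFun { rfun :> proj R n -> R[i]; rfunP : is_regular U rfun }.

Lemma regfun_eq U (f g : regfun U) : (forall p, U p -> f p = g p) -> f = g.
Proof.
case: f g => [f fP] [g gP] /= fg.
suff E : f = g by case: _ / E gP => gP; congr RegFun; exact: Prop_irrelevance.
apply/funext=> p; have [/fg//|nUp] := pselect (U p).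
by rewrite (proj1 fP)// (proj1 gP).
Qed.

Definition cut (U : open) (f : proj R n -> R[i]) : proj R n -> R[i] :=
  fun p => if pselect (U p) then f p else 0.

Lemma cutT (U : open) f p : U p -> cut U f p = f p.
Proof. by rewrite /cut; case: pselect. Qed.

Lemma cutF (U : open) f p : ~ U p -> cut U f p = 0.
Proof. by rewrite /cut; case: pselect. Qed.

Lemma regular_const U c : is_regular U (cut U (fun=> c)).
Proof.
split=> [p|p Up]; first exact: cutF.
exists 0%N, (c%:MP), 1; split; first by rewrite -alg_mpolyC; apply: dhomogZ; exact: dhomog1.
- exact: dhomog1.
- by rewrite /hev meval1 oner_eq0.
- by move=> q Uq _; rewrite cutT// /hev mevalC meval1 divr1.
Qed.

Lemma regular_add U (f g : regfun U) : is_regular U (fun p => f p + g p).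
Proof.
case: f g => [f [f0 fU]] [g [g0 gU]] /=; split=> [p nUp|p Up].
  by rewrite f0// g0// addr0.
have [d [a [b [ha hb bp E]]]] := fU p Up.
have [e [a' [b' [ha' hb' bp' E']]]] := gU p Up.
exists (d + e)%N, (a * b' + a' * b), (b * b'); split.
- by apply: rpredD; [|rewrite addnC]; apply: dhomogM.
- exact: dhomogM.
- by rewrite hevM mulf_neq0.
move=> q Uq; rewrite hevM mulf_eq0 negb_or => /andP[bq b'q].
by rewrite E// E'// /hev mevalD !mevalM addf_div.
Qed.

Lemma regular_mul U (f g : regfun U) : is_regular U (fun p => f p * g p).
Proof.
case: f g => [f [f0 fU]] [g [g0 gU]] /=; split=> [p nUp|p Up].
  by rewrite f0// mul0r.
have [d [a [b [ha hb bp E]]]] := fU p Up.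
have [e [a' [b' [ha' hb' bp' E']]]] := gU p Up.
exists (d + e)%N, (a * a'), (b * b'); split; try exact: dhomogM.
  by rewrite hevM mulf_neq0.
move=> q Uq; rewrite hevM mulf_eq0 negb_or => /andP[bq b'q].
by rewrite E// E'// !hevM mulf_div.
Qed.

Lemma regular_opp U (f : regfun U) : is_regular U (fun p => - f p).
Proof.
case: f => [f [f0 fU]] /=; split=> [p nUp|p Up]; first by rewrite f0// oppr0.
have [d [a [b [ha hb bp E]]]] := fU p Up.
exists d, (- a), b; split=> //; first by rewrite rpredN.
by move=> q Uq bq; rewrite E// /hev mevalN mulNr.
Qed.

Lemma regular_res U W (f : regfun U) :
  is_regular W (cut W (if pselect (W `<=o` U) then f : _ -> _ else fun=> 0)).
Proof.
case: pselect => [WU|nWU] /=; last exact: regular_const.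
have [f0 fU] := rfunP f; split=> [p|p Wp]; first exact: cutF.
have [d [a [b [ha hb bp E]]]] := fU p (WU p Wp).
by exists d, a, b; split=> // q Wq bq; rewrite cutT// E//; apply: WU.
Qed.

HB.instance Definition _ U := gen_eqMixin (regfun U).
HB.instance Definition _ U := gen_choiceMixin (regfun U).

Definition rf_const U c : regfun U := RegFun (regular_const U c).
Definition rf_add U f g : regfun U := RegFun (@regular_add U f g).
Definition rf_mul U f g : regfun U := RegFun (@regular_mul U f g).
Definition rf_opp U f : regfun U := RegFun (@regular_opp U f).
Definition rf_res U W f : regfun W := RegFun (@regular_res U W f).

Fact rf_addA U : associative (@rf_add U).
Proof. by move=> f g h; apply: regfun_eq => p _ /=; rewrite addrA. Qed.
Fact rf_addC U : commutative (@rf_add U).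
Proof. by move=> f g; apply: regfun_eq => p _ /=; rewrite addrC. Qed.
Fact rf_add0 U : left_id (rf_const U 0) (@rf_add U).
Proof. by move=> f; apply: regfun_eq => p Up /=; rewrite cutT// add0r. Qed.
Fact rf_addN U : left_inverse (rf_const U 0) (@rf_opp U) (@rf_add U).
Proof. by move=> f; apply: regfun_eq => p Up /=; rewrite cutT// addNr. Qed.
Fact rf_mulA U : associative (@rf_mul U).
Proof. by move=> f g h; apply: regfun_eq => p _ /=; rewrite mulrA. Qed.
Fact rf_mulC U : commutative (@rf_mul U).
Proof. by move=> f g; apply: regfun_eq => p _ /=; rewrite mulrC. Qed.
Fact rf_mul1 U : left_id (rf_const U 1) (@rf_mul U).
Proof. by move=> f; apply: regfun_eq => p Up /=; rewrite cutT// mul1r. Qed.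
Fact rf_mulr1 U : right_id (rf_const U 1) (@rf_mul U).
Proof. by move=> f; apply: regfun_eq => p Up /=; rewrite cutT// mulr1. Qed.
Fact rf_mulDl U : left_distributive (@rf_mul U) (@rf_add U).
Proof. by move=> f g h; apply: regfun_eq => p _ /=; rewrite mulrDl. Qed.
Fact rf_mulDr U : right_distributive (@rf_mul U) (@rf_add U).
Proof. by move=> f g h; apply: regfun_eq => p _ /=; rewrite mulrDr. Qed.

HB.instance Definition _ U := GRing.isPzRing.Build (regfun U)
  (@rf_addA U) (@rf_addC U) (@rf_add0 U) (@rf_addN U)
  (@rf_mulA U) (@rf_mul1 U) (@rf_mulr1 U) (@rf_mulDl U) (@rf_mulDr U).
HB.instance Definition _ U :=
  GRing.PzRing_hasCommutativeMul.Build (regfun U) (@rf_mulC U).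

Lemma rf_resE U W (f : regfun U) p : W `<=o` U -> W p -> rf_res W f p = f p.
Proof. by move=> WU Wp; rewrite /= cutT//; case: pselect. Qed.

Lemma rf_sheaf : @is_sheaf R n X (fun U => regfun U) rf_res.
Proof.
split.
- move=> U W WU s t; apply: regfun_eq => p Wp.
  by rewrite rf_resE//=; congr (_ + _); rewrite -(rf_resE _ WU Wp).
- by move=> U s; apply: regfun_eq => p Up; rewrite rf_resE.
- move=> U W Z WU ZW s; apply: regfun_eq => p Zp.
  by rewrite !rf_resE//; [apply: subset_trans WU|apply: ZW].
- move=> U s t st; apply: regfun_eq => p Up; have [W [Wp WU E]] := st p Up.
  by rewrite -(rf_resE s WU Wp) E rf_resE.
move=> U c s cU Uc cs.
pose f p := if pselect (exists W, c W /\ W p) is left H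
  then s (projT1 (cid H)) p else 0.
have fE W p : c W -> W p -> f p = s W p.
  move=> cW Wp; rewrite /f; case: pselect => [H|[]]; last by exists W.
  case: (cid H) => W' [cW' W'p] /=.
  have IL : oI W' W `<=o` W' by move=> ? [].
  have IR : oI W' W `<=o` W by move=> ? [].
  have pI : oI W' W p by [].
  by rewrite -(rf_resE (s W') IL pI) (cs _ _ _ cW' cW IL IR) rf_resE.
have fU : is_regular U f.
  split=> p Up.
    rewrite /f; case: pselect => // -[W [cW Wp]].
    by case: Up; apply: cU Wp.
  have [W cW Wp] := Uc p Up; have [_ /(_ p Wp)] := rfunP (s W).
  case=> d [a [b [ha hb bp E]]].
  have [WX [A oA WE]] := open_prop W.
  have Ap : A p by move: Wp; rewrite WE => -[].
  have [e [l [hl lp lA]]] := oA p Ap.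
  exists (d + e)%N, (a * l), (b * l); split; try exact: dhomogM.
    by rewrite hevM mulf_neq0.
  move=> q Uq; rewrite !hevM mulf_eq0 negb_or => /andP[bq lq].
  have Wq : W q by rewrite WE; split; [case: (open_prop U) => + _; apply|apply: lA].
  by rewrite (fE W)// E// -mulf_div divff// mulr1.
exists (RegFun fU) => W cW; apply: regfun_eq => p Wp.
by rewrite rf_resE//=; [apply: fE|apply: cU].
Qed.

Lemma rf_res1 U W : W `<=o` U -> rf_res W (1 : regfun U) = 1.
Proof.
move=> WU; apply: regfun_eq => p Wp; rewrite rf_resE//=.
by rewrite !cutT//; apply: WU.
Qed.

Lemma rf_resM U W : W `<=o` U -> forall s t : regfun U,
  rf_res W (s * t) = rf_res W s * rf_res W t.
Proof.
move=> WU s t; apply: regfun_eq => p Wp.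
by rewrite rf_resE//=; congr (_ * _); rewrite -(rf_resE _ WU Wp).
Qed.

Definition Osh : rsheaf X := RSheaf rf_sheaf rf_res1 rf_resM.

End StructureSheaf.

(** * Endomorphisms of the sheaf O_U, and differential curves *)

Section Endomorphisms.
Variables (R : realType) (n : nat) (X : set (proj R n)).
Local Notation open := (open X).
Local Notation regfun := (@regfun R n X).
Implicit Types U W Z : open.

Definition is_endo U (e : forall W, W `<=o` U -> regfun W -> regfun W) :=
  (forall W WU f g, e W WU (f + g) = e W WU f + e W WU g) /\
  (forall W Z (WU : W `<=o` U) (ZU : Z `<=o` U), Z `<=o` W ->
    forall f, rf_res Z (e W WU f) = e Z ZU (rf_res Z f)).

Record endo U : Type := Endo {
  efun :> forall W, W `<=o` U -> regfun W -> regfun W;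
  efunP : is_endo efun }.

Lemma endo_eq U (P Q : endo U) : (forall W WU f, P W WU f = Q W WU f) -> P = Q.
Proof.
case: P Q => [e eP] [e' eP'] /= ee'.
have E : e = e'.
  apply: functional_extensionality_dep => W.
  by apply: functional_extensionality_dep => WU; apply/funext => f.
by case: _ / E eP' => eP'; congr Endo; exact: Prop_irrelevance.
Qed.

Lemma endoD U (P : endo U) W WU f g : P W WU (f + g) = P W WU f + P W WU g.
Proof. exact: (proj1 (efunP P)). Qed.

Lemma endo_nat U (P : endo U) W Z (WU : W `<=o` U) (ZU : Z `<=o` U) f :
  Z `<=o` W -> rf_res Z (P W WU f) = P Z ZU (rf_res Z f).
Proof. by move=> ZW; apply: (proj2 (efunP P)). Qed.

Let resD U W (WU : W `<=o` U) := sh_add (rf_sheaf X) WU.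
Let res0 U W (WU : W `<=o` U) := is_sheaf_res0 (rf_sheaf X) WU.

Let resN U W (WU : W `<=o` U) (f : regfun U) : rf_res W (- f) = - rf_res W f.
Proof. by apply: (addrI (rf_res W f)); rewrite -resD// !subrr res0. Qed.

Lemma zero_endoP U : @is_endo U (fun W _ _ => 0).
Proof. by split=> [W _ _ _|W Z _ _ ZW _]; rewrite ?addr0// res0. Qed.

Lemma add_endoP U (P Q : endo U) : @is_endo U (fun W WU f => P W WU f + Q W WU f).
Proof.
split=> [W WU f g|W Z WU ZU ZW f]; first by rewrite !endoD addrACA.
by rewrite resD// !(endo_nat _ _ ZU).
Qed.

Lemma opp_endoP U (P : endo U) : @is_endo U (fun W WU f => - P W WU f).
Proof.
split=> [W WU f g|W Z WU ZU ZW f]; first by rewrite !endoD opprD.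
by rewrite resN// !(endo_nat _ _ ZU).
Qed.

Lemma one_endoP U : @is_endo U (fun W _ f => f).
Proof. by split. Qed.

Lemma comp_endoP U (P Q : endo U) : @is_endo U (fun W WU f => P W WU (Q W WU f)).
Proof.
split=> [W WU f g|W Z WU ZU ZW f]; first by rewrite !endoD.
by rewrite !(endo_nat _ _ ZU).
Qed.

HB.instance Definition _ U := gen_eqMixin (endo U).
HB.instance Definition _ U := gen_choiceMixin (endo U).

Definition endo0 U : endo U := Endo (zero_endoP U).
Definition endo_add U P Q : endo U := Endo (@add_endoP U P Q).
Definition endo_opp U P : endo U := Endo (@opp_endoP U P).
Definition endo1 U : endo U := Endo (one_endoP U).
Definition endo_comp U P Q : endo U := Endo (@comp_endoP U P Q).

Fact endo_addA U : associative (@endo_add U).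
Proof. by move=> P Q S; apply: endo_eq => W WU f /=; rewrite addrA. Qed.
Fact endo_addC U : commutative (@endo_add U).
Proof. by move=> P Q; apply: endo_eq => W WU f /=; rewrite addrC. Qed.
Fact endo_add0 U : left_id (endo0 U) (@endo_add U).
Proof. by move=> P; apply: endo_eq => W WU f /=; rewrite add0r. Qed.
Fact endo_addN U : left_inverse (endo0 U) (@endo_opp U) (@endo_add U).
Proof. by move=> P; apply: endo_eq => W WU f /=; rewrite addNr. Qed.
Fact endo_compA U : associative (@endo_comp U).
Proof. by move=> P Q S; apply: endo_eq. Qed.
Fact endo_comp1 U : left_id (endo1 U) (@endo_comp U).
Proof. by move=> P; apply: endo_eq. Qed.
Fact endo_compr1 U : right_id (endo1 U) (@endo_comp U).
Proof. by move=> P; apply: endo_eq. Qed.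
Fact endo_compDl U : left_distributive (@endo_comp U) (@endo_add U).
Proof. by move=> P Q S; apply: endo_eq. Qed.
Fact endo_compDr U : right_distributive (@endo_comp U) (@endo_add U).
Proof. by move=> P Q S; apply: endo_eq => W WU f /=; rewrite endoD. Qed.

HB.instance Definition _ U := GRing.isPzRing.Build (endo U)
  (@endo_addA U) (@endo_addC U) (@endo_add0 U) (@endo_addN U)
  (@endo_compA U) (@endo_comp1 U) (@endo_compr1 U)
  (@endo_compDl U) (@endo_compDr U).

Lemma mulopP U (f : regfun U) : @is_endo U (fun W _ g => rf_res W f * g).
Proof.
split=> [W WU g h|W Z WU ZU ZW g]; first by rewrite mulrDr.
by rewrite rf_resM// (sh_comp (rf_sheaf X)).
Qed.

Definition mulop U (f : regfun U) : endo U := Endo (mulopP f).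

Lemma res_endoP U W (P : endo U) (WU : W `<=o` U) :
  @is_endo W (fun Z ZW => P Z (subset_trans ZW WU)).
Proof.
by split=> [Z ZW f g|Z Y ZW YW YZ f]; rewrite ?endoD//; apply: endo_nat.
Qed.

Definition endo_res U W (P : endo U) : endo W :=
  if pselect (W `<=o` U) is left WU then Endo (res_endoP P WU) else 0.

Lemma endo_resE U W (P : endo U) (WU : W `<=o` U) Z (ZW : Z `<=o` W)
    (ZU : Z `<=o` U) f : endo_res W P Z ZW f = P Z ZU f.
Proof.
rewrite /endo_res; case: pselect => // WU' /=.
by congr (P Z _ f); exact: Prop_irrelevance.
Qed.

Lemma endo_sheaf : @is_sheaf R n X (fun U => endo U) endo_res.
Proof.
split.
- move=> U W WU P Q; apply: endo_eq => Z ZW f /=.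
  by rewrite !(endo_resE _ WU _ (subset_trans ZW WU)).
- by move=> U P; apply: endo_eq => W WU f; rewrite (endo_resE _ _ _ WU).
- move=> U W Z WU ZW P; apply: endo_eq => Y YZ f.
  have YW := subset_trans YZ ZW; have YU := subset_trans YW WU.
  rewrite (endo_resE _ ZW _ YW) (endo_resE _ WU _ YU).
  by rewrite (endo_resE _ (subset_trans ZW WU) _ YU).
- move=> U P Q PQ; apply: endo_eq => W WU f.
  apply: (sh_sep (rf_sheaf X)) => p Wp; have [Z [Zp ZU E]] := PQ p (WU p Wp).
  exists (oI W Z); split=> //; first by move=> ? [].
  have IW : oI W Z `<=o` W by move=> ? [].
  have IZ : oI W Z `<=o` Z by move=> ? [].
  have IU : oI W Z `<=o` U by apply: subset_trans WU.
  rewrite !(endo_nat _ _ IU)//.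
  by rewrite -(endo_resE _ ZU IZ) E (endo_resE _ ZU IZ).
move=> U c s cU Uc cs.
have compat W W' Y (YW : Y `<=o` W) (YW' : Y `<=o` W') f : c W -> c W' ->
    s W Y YW f = s W' Y YW' f.
  move=> cW cW'; have YY : Y `<=o` Y by [].
  by rewrite -(endo_resE _ YW YY) (cs _ _ _ cW cW' YW YW') (endo_resE _ YW' YY).
have ex Z (ZU : Z `<=o` U) (f : regfun Z) : exists t : regfun Z,
    forall W Y (YW : Y `<=o` W), c W -> Y `<=o` Z ->
      rf_res Y t = s W Y YW (rf_res Y f).
  pose c' (Y : open) := Y `<=o` Z /\ exists2 W, c W & Y `<=o` W.
  have exY Y : exists g : regfun Y, forall W (YW : Y `<=o` W), c W ->
      g = s W Y YW (rf_res Y f).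
    have [[W cW YW]|nW] := pselect (exists2 W, c W & Y `<=o` W); last first.
      by exists 0 => W YW cW; case: nW; exists W.
    by exists (s W Y YW (rf_res Y f)) => W' YW' cW'; apply: compat.
  pose g Y := projT1 (cid (exY Y)).
  have gE Y : forall W (YW : Y `<=o` W), c W -> g Y = s W Y YW (rf_res Y f).
    by rewrite /g; case: cid.
  have [||Y Y' T [YZ [W cW YW]] [Y'Z [W' cW' YW']] TY TY'|t tE] :=
      @sh_glue _ _ _ _ _ (rf_sheaf X) Z c' g.
  - by move=> Y [].
  - move=> p Zp; have [W cW Wp] := Uc p (ZU p Zp).
    exists (oI Z W) => //; split; first by move=> ? [].
    by exists W => // ? [].
  - rewrite (gE _ _ YW cW) (gE _ _ YW' cW').
    rewrite (endo_nat _ _ (subset_trans TY YW))//.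
    rewrite (endo_nat _ _ (subset_trans TY' YW'))//.
    rewrite !(sh_comp (rf_sheaf X))//.
    exact: compat.
  exists t => W Y YW cW YZ; rewrite tE; last by split=> //; exists W.
  exact: gE.
pose e Z ZU f := projT1 (cid (ex Z ZU f)).
have eE Z ZU f : forall W Y (YW : Y `<=o` W), c W -> Y `<=o` Z ->
    rf_res Y (e Z ZU f) = s W Y YW (rf_res Y f).
  by rewrite /e; case: cid.
have loc Z (ZU : Z `<=o` U) (g h : regfun Z) :
    (forall W Y, Y `<=o` W -> c W -> Y `<=o` Z -> rf_res Y g = rf_res Y h) ->
    g = h.
  move=> gh; apply: (sh_sep (rf_sheaf X)) => p Zp.
  have [W cW Wp] := Uc p (ZU p Zp).
  have IZ : oI Z W `<=o` Z by move=> ? [].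
  have IW : oI Z W `<=o` W by move=> ? [].
  by exists (oI Z W); split=> //; apply: gh IW cW IZ.
have eP : is_endo e.
  split=> [Z ZU f g|Z T ZU TU TZ f].
    apply: (loc _ ZU) => W Y YW cW YZ.
    by rewrite resD// !(eE _ _ _ _ _ YW)// resD// endoD.
  apply: (loc _ TU) => W Y YW cW YT.
  have YZ := subset_trans YT TZ.
  rewrite (sh_comp (rf_sheaf X))// !(eE _ _ _ _ _ YW)//.
  by rewrite (sh_comp (rf_sheaf X)).
exists (Endo eP) => W cW; apply: endo_eq => Z ZW f.
have ZU := subset_trans ZW (cU _ cW).
rewrite (endo_resE _ (cU _ cW) _ ZU) /=.
have ZZ : Z `<=o` Z by [].
rewrite -[LHS](sh_id (rf_sheaf X)) (eE _ _ _ _ _ ZW)//.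
by rewrite (sh_id (rf_sheaf X)).
Qed.

Lemma endo_res1 U W : W `<=o` U -> endo_res W (1 : endo U) = 1.
Proof.
move=> WU; apply: endo_eq => Z ZW f.
by rewrite (endo_resE _ WU _ (subset_trans ZW WU)).
Qed.

Lemma endo_resM U W : W `<=o` U -> forall P Q : endo U,
  endo_res W (P * Q) = endo_res W P * endo_res W Q.
Proof.
move=> WU P Q; apply: endo_eq => Z ZW f /=.
by rewrite !(endo_resE _ WU _ (subset_trans ZW WU)).
Qed.

Lemma endo_res_mulop U W (f : regfun U) : W `<=o` U ->
  endo_res W (mulop f) = mulop (rf_res W f).
Proof.
move=> WU; apply: endo_eq => Z ZW g /=.
rewrite (endo_resE _ WU _ (subset_trans ZW WU)) /=.
by rewrite (sh_comp (rf_sheaf X)).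
Qed.

Definition is_derivation U (P : endo U) : Prop :=
  (forall W WU f g, P W WU (f * g) = P W WU f * g + f * P W WU g) /\
  (forall W WU c, P W WU (rf_const W c) = 0).

Definition translation_invariant (G : set (proj R n))
    (m : proj R n -> proj R n -> proj R n) (P : endo (oT X)) : Prop :=
  forall g, G g -> forall W W', oset W `<=` G -> oset W' `<=` G ->
  (forall q, W' q -> W (m g q)) ->
  forall (f : regfun W) (f' : regfun W'),
    (forall q, W' q -> f' q = f (m g q)) ->
    forall q, W' q ->
      P W' (@open_subT _ _ _ W') f' q = P W (@open_subT _ _ _ W) f (m g q).

End Endomorphisms.

Definition is_weierstrass_cubic (R : realType) (n : nat) (X : set (proj R n))
    (o : proj R n) : Prop :=
  [/\ is_curve X, zclosed X, arithmetic_genus X 1 & smooth_locus X o].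

Record dcurve (R : realType) : Type := DCurve {
  dc_dim : nat;
  dc_pts :> set (proj R dc_dim);
  dc_cubic : bool;
  dc_vf : endo (oT dc_pts);
  dc_der : is_derivation dc_vf;
  dc_ax : if dc_cubic then
      exists o m inv, [/\ is_weierstrass_cubic dc_pts o,
        algebraic_group (smooth_locus dc_pts) o m inv, dc_vf <> 0 &
        translation_invariant (smooth_locus dc_pts) m dc_vf]
    else is_curve dc_pts /\ forall p, dc_pts p -> smooth_at dc_pts p }.

Arguments dc_pts {R} d _.

(** * Differential operators *)

Section DifferentialOperators.
Variables (R : realType) (X : dcurve R).
Local Notation open := (open X).
Implicit Types U W Z : open.

(* The module generating D over O: all vector fields on a smooth curve, but
   only the multiples of the chosen one on a cubic. *)
Definition vector_field U (P : endo U) : Prop :=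
  if dc_cubic X then exists f, P = mulop f * endo_res U (dc_vf X)
  else is_derivation P.

Inductive dgen U : nat -> endo U -> Prop :=
| dgen_fun f : dgen 0 (mulop f)
| dgen_vf P : vector_field P -> dgen 1 P
| dgen_add k P Q : dgen k P -> dgen k Q -> dgen k (P + Q)
| dgen_mul k l P Q : dgen k P -> dgen l Q -> dgen (k + l) (P * Q)
| dgen_le k l P : (k <= l)%N -> dgen k P -> dgen l P.

Definition locally U (Q : open -> Prop) : Prop :=
  forall p, U p -> exists W, [/\ W p, W `<=o` U & Q W].

Definition is_diffop U (P : endo U) : Prop :=
  locally U (fun W => exists k, dgen k (endo_res W P)).

Definition diffop_pred U : {pred endo U} :=
  fun P : endo U => `[< is_diffop P >].
Arguments diffop_pred : clear implicits.

Lemma vector_field_res U W (P : endo U) : W `<=o` U ->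
  vector_field P -> vector_field (endo_res W P).
Proof.
rewrite /vector_field => WU; case: (dc_cubic X) => [[f ->]|[PM P0]].
  exists (rf_res W f); rewrite endo_resM// endo_res_mulop//.
  by rewrite (sh_comp (endo_sheaf X))//; exact: open_subT.
split=> [Z ZW f g|Z ZW c].
  by rewrite !(endo_resE _ WU _ (subset_trans ZW WU)) PM.
by rewrite !(endo_resE _ WU _ (subset_trans ZW WU)) P0.
Qed.

Lemma dgen_res U W k (P : endo U) : W `<=o` U ->
  dgen k P -> dgen k (endo_res W P).
Proof.
move=> WU; elim=> {k P} [f|P vP|k P Q _ IP _ IQ|k l P Q _ IP _ IQ|k l P kl _ IP].
- by rewrite endo_res_mulop//; exact: dgen_fun.
- by apply: dgen_vf; apply: vector_field_res.
- by rewrite (sh_add (endo_sheaf X))//; exact: dgen_add.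
- by rewrite endo_resM//; exact: dgen_mul.
- exact: dgen_le IP.
Qed.

Lemma mulop1 U : mulop (1 : regfun U) = 1.
Proof. by apply: endo_eq => W WU f /=; rewrite rf_res1// mul1r. Qed.

Lemma mulopN1 U : mulop (- 1 : regfun U) = - 1.
Proof.
apply: endo_eq => W WU f; apply: regfun_eq => p Wp.
rewrite [LHS]/= cutT//; case: pselect => // nWU /=.
by rewrite cutT ?mulN1r//; apply: WU.
Qed.

Lemma dgen_opp U k (P : endo U) : dgen k P -> dgen k (- P).
Proof.
move=> gP; rewrite -mulN1r -mulopN1 -[k]add0n; apply: dgen_mul => //.
exact: dgen_fun.
Qed.

Lemma diffop_two U (P Q S : endo U) :
  (forall W k l, W `<=o` U -> dgen k (endo_res W P) -> dgen l (endo_res W Q) ->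
     exists m, dgen m (endo_res W S)) ->
  is_diffop P -> is_diffop Q -> is_diffop S.
Proof.
move=> H dP dQ p Up; have [W [Wp WU [k gP]]] := dP p Up.
have [Z [Zp ZU [l gQ]]] := dQ p Up.
have IW : oI W Z `<=o` W by move=> ? [].
have IZ : oI W Z `<=o` Z by move=> ? [].
have IU := subset_trans IW WU.
exists (oI W Z); split=> //; apply: (H _ k l) => //.
  by rewrite -(sh_comp (endo_sheaf X) WU IW); apply: dgen_res.
by rewrite -(sh_comp (endo_sheaf X) ZU IZ); apply: dgen_res.
Qed.

Lemma diffop_subring U : subring_closed (diffop_pred U).
Proof.
split=> [|P Q /asboolP dP /asboolP dQ|P Q /asboolP dP /asboolP dQ]; apply/asboolP.
- move=> p Up; exists U; split=> //; exists 0%N.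
  by rewrite endo_res1// -mulop1; exact: dgen_fun.
- apply: diffop_two dP dQ => W k l WU gP gQ; exists (k + l)%N.
  have -> : endo_res W (P - Q) = endo_res W P - endo_res W Q.
    apply: endo_eq => Z ZW f /=.
    by rewrite !(endo_resE _ WU _ (subset_trans ZW WU)).
  apply: dgen_add; first exact: dgen_le (leq_addr _ _) gP.
  by apply: dgen_le (leq_addl _ _) _; exact: dgen_opp.
- apply: diffop_two dP dQ => W k l WU gP gQ; exists (k + l)%N.
  by rewrite endo_resM//; exact: dgen_mul.
Qed.

Record diffop U : Type :=
  DiffOp { dval :> endo U; dvalP : diffop_pred U dval }.

HB.instance Definition _ U := [isSub for @dval U].
HB.instance Definition _ U := [Choice of diffop U by <:].
HB.instance Definition _ U :=
  GRing.SubChoice_isSubPzRing.Build (endo U) (diffop_pred U) (diffop U)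
    (@diffop_subring U).

Lemma diffop_res_subproof U W (P : diffop U) : diffop_pred W (endo_res W P).
Proof.
apply/asboolP; have [WU|nWU] := pselect (W `<=o` U); last first.
  have -> : endo_res W P = 0 by rewrite /endo_res; case: pselect.
  move=> p Wp; exists W; split=> //; exists 0%N.
  rewrite -(subrr (1 : endo W)) (sh_id (endo_sheaf X)) -mulop1.
  by apply: dgen_add; [|apply: dgen_opp]; exact: dgen_fun.
move=> p Wp; have /asboolP/(_ p (WU p Wp)) [Z [Zp ZU [k gP]]] := dvalP P.
have IW : oI W Z `<=o` W by move=> ? [].
have IZ : oI W Z `<=o` Z by move=> ? [].
exists (oI W Z); split=> //; exists k.
rewrite (sh_comp (endo_sheaf X))//.
by rewrite -(sh_comp (endo_sheaf X) ZU IZ); apply: dgen_res.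
Qed.

Definition diffop_res U W (P : diffop U) : diffop W :=
  DiffOp (@diffop_res_subproof U W P).

Lemma diffop_sheaf : @is_sheaf R _ X (fun U => diffop U) diffop_res.
Proof.
split.
- by move=> U W WU P Q; apply: val_inj; exact: (sh_add (endo_sheaf X)).
- by move=> U P; apply: val_inj; exact: (sh_id (endo_sheaf X)).
- by move=> U W Z WU ZW P; apply: val_inj; exact: (sh_comp (endo_sheaf X)).
- move=> U P Q PQ; apply: val_inj; apply: (sh_sep (endo_sheaf X)) => p Up.
  by have [W [Wp WU [E]]] := PQ p Up; exists W.
move=> U c s cU Uc cs.
have [W W' Z cW cW' ZW ZW'|t tE] := sh_glue (endo_sheaf X)
    (s := fun W => dval (s W)) cU Uc.
  by have [] := cs _ _ _ cW cW' ZW ZW'.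
have dt : diffop_pred U t.
  apply/asboolP => p Up; have [W cW Wp] := Uc p Up.
  have /asboolP/(_ p Wp) [Z [Zp ZW [k gP]]] := dvalP (s W).
  exists Z; split=> //; first exact: subset_trans (cU _ cW).
  by exists k; rewrite -(sh_comp (endo_sheaf X) (cU _ cW) ZW) tE.
by exists (DiffOp dt) => W cW; apply: val_inj; rewrite /= tE.
Qed.

Lemma diffop_res1 U W : W `<=o` U -> diffop_res W (1 : diffop U) = 1.
Proof. by move=> WU; apply: val_inj; exact: endo_res1. Qed.

Lemma diffop_resM U W : W `<=o` U -> forall P Q : diffop U,
  diffop_res W (P * Q) = diffop_res W P * diffop_res W Q.
Proof. by move=> WU P Q; apply: val_inj; exact: endo_resM. Qed.

Definition Dsh : rsheaf X := RSheaf diffop_sheaf diffop_res1 diffop_resM.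

Definition Dfil (k : int) U (P : Dsh U) : Prop :=
  match k with
  | Posz k => locally U (fun W => dgen k (endo_res W (dval P)))
  | Negz _ => P = 0
  end.

Lemma mulop_diffop U (f : Osh X U) : diffop_pred U (mulop f).
Proof.
apply/asboolP => p Up; exists U; split=> //; exists 0%N.
by rewrite endo_res_mulop//; exact: dgen_fun.
Qed.

Definition O2D_fun U (f : Osh X U) : Dsh U := DiffOp (mulop_diffop f).

Fact O2D_D U (f g : Osh X U) : O2D_fun (f + g) = O2D_fun f + O2D_fun g.
Proof.
apply: val_inj; apply: endo_eq => W WU h /=.
by rewrite (sh_add (rf_sheaf X))// mulrDl.
Qed.

Fact O2D_1 U : O2D_fun (1 : Osh X U) = 1.
Proof. by apply: val_inj; exact: mulop1. Qed.

Fact O2D_M U (f g : Osh X U) : O2D_fun (f * g) = O2D_fun f * O2D_fun g.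
Proof.
apply: val_inj; apply: endo_eq => W WU h /=.
by rewrite rf_resM// mulrA.
Qed.

Fact O2D_res U W : W `<=o` U ->
  forall f : Osh X U, O2D_fun (rres W f) = rres W (O2D_fun f).
Proof. by move=> WU f; apply: val_inj; rewrite /= endo_res_mulop. Qed.

Definition O2D : rmap (Osh X) Dsh := RMap O2D_D O2D_1 O2D_M O2D_res.

Lemma vf_diffop : diffop_pred (oT X) (dc_vf X).
Proof.
apply/asboolP => p Up; exists (oT X); split=> //; exists 1%N.
rewrite (sh_id (endo_sheaf X)); apply: dgen_vf.
rewrite /vector_field; have dv := dc_der X; case: (dc_cubic X) => //.
by exists 1; rewrite mulop1 mul1r (sh_id (endo_sheaf X)).
Qed.

Definition Dvf : Dsh (oT X) := DiffOp vf_diffop.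

End DifferentialOperators.

(** * Morphisms, free modules, extension of scalars *)

Section Modules.
Variables (R : realType) (n : nat) (X : set (proj R n)).
Local Notation open := (open X).
Implicit Types U W Z : open.

Definition rid (A : rsheaf X) : rmap A A :=
  @RMap _ _ _ A A (fun _ a => a) (fun _ _ _ => erefl) (fun _ => erefl)
    (fun _ _ _ => erefl) (fun _ _ _ _ => erefl).

Program Definition rcomp (A B C : rsheaf X) (f : rmap A B) (g : rmap B C) :
  rmap A C := @RMap _ _ _ A C (fun U a => g U (f U a)) _ _ _ _.
Next Obligation. by rewrite !rmapD. Qed.
Next Obligation. by rewrite !rmap1. Qed.
Next Obligation. by rewrite !rmapM. Qed.
Next Obligation. by rewrite !rmap_res. Qed.

Program Definition rrestr (A B : rsheaf X) (f : rmap A B) (N : rmod B) : rmod A :=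
  @RMod _ _ _ A N (@mres _ _ _ _ N) (fun U m a => mact m (f U a))
    (rmodP N) _ _ _ _ _.
Next Obligation. by rewrite mactDl. Qed.
Next Obligation. by rewrite rmapD mactDr. Qed.
Next Obligation. by rewrite rmap1 mact1. Qed.
Next Obligation. by rewrite rmapM mactM. Qed.
Next Obligation. by rewrite rmap_res// mact_res. Qed.

(* Families of maps defined on all opens: a family represents a morphism over
   U through its members at the opens contained in U. *)
Definition eq_over U (F : open -> Type) (G : open -> Type)
    (g h : forall W, F W -> G W) : Prop :=
  forall W, W `<=o` U -> forall x, g W x = h W x.

(* Morphisms over U along a change of rings. *)
Definition is_slin (A B : rsheaf X) (f : rmap A B) U (M : rmod A) (N : rmod B)
    (h : forall W, M W -> N W) : Prop :=
  forall W, W `<=o` U ->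
    [/\ forall m m', h W (m + m') = h W m + h W m',
        forall m a, h W (m *a a) = h W m *a f W a &
        forall Z, Z `<=o` W -> forall m, h Z (mres Z m) = mres Z (h W m)].

Definition is_hom (A : rsheaf X) U (M N : rmod A) (h : forall W, M W -> N W) :=
  is_slin (rid A) U h.

Definition are_inverse (A : rsheaf X) U (M N : rmod A)
    (h : forall W, M W -> N W) (g : forall W, N W -> M W) : Prop :=
  eq_over U (fun W x => g W (h W x)) (fun W x => x) /\
  eq_over U (fun W x => h W (g W x)) (fun W x => x).

Definition is_iso (A : rsheaf X) U (M N : rmod A) (h : forall W, M W -> N W) :=
  is_hom U h /\ exists2 g, is_hom U g & are_inverse U h g.

Section Free.
Variables (A : rsheaf X) (r : nat).

Definition free_res U W (x : {ffun 'I_r -> A U}) : {ffun 'I_r -> A W} :=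
  [ffun i => rres W (x i)].

Definition free_act U (x : {ffun 'I_r -> A U}) (a : A U) : {ffun 'I_r -> A U} :=
  [ffun i => x i * a].

Lemma free_sheaf : @is_sheaf R n X (fun U => {ffun 'I_r -> A U}) free_res.
Proof.
have sA := rsheafP A; split.
- by move=> U W WU x y; apply/ffunP => i; rewrite !ffunE (sh_add sA).
- by move=> U x; apply/ffunP => i; rewrite ffunE (sh_id sA).
- by move=> U W Z WU ZW x; apply/ffunP => i; rewrite !ffunE (sh_comp sA).
- move=> U x y xy; apply/ffunP => i; apply: (sh_sep sA) => p Up.
  have [W [Wp WU /ffunP/(_ i)]] := xy p Up; rewrite !ffunE => E.
  by exists W.
move=> U c s cU Uc cs.
have ex i : exists t : A U, forall W, c W -> rres W t = s W i.
  apply: (@sh_glue _ _ _ _ _ sA U c (fun W => s W i) cU Uc).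
  move=> W W' Z cW cW' ZW ZW'.
  by have /ffunP/(_ i) := cs _ _ _ cW cW' ZW ZW'; rewrite !ffunE.
exists [ffun i => projT1 (cid (ex i))] => W cW.
by apply/ffunP => i; rewrite !ffunE; case: cid => /= t; apply.
Qed.

Program Definition rfree : rmod A :=
  @RMod _ _ _ A (fun U => {ffun 'I_r -> A U}) free_res free_act free_sheaf
    _ _ _ _ _.
Next Obligation. by apply/ffunP => i; rewrite !ffunE mulrDl. Qed.
Next Obligation. by apply/ffunP => i; rewrite !ffunE mulrDr. Qed.
Next Obligation. by apply/ffunP => i; rewrite !ffunE mulr1. Qed.
Next Obligation. by apply/ffunP => i; rewrite !ffunE mulrA. Qed.
Next Obligation. by apply/ffunP => i; rewrite !ffunE rresM. Qed.

End Free.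

(* A tensor product of sheaves M ⊗_A B, given by its universal property (over
   every open subset): semilinear maps out of M factor uniquely. *)
Record tensor (A B : rsheaf X) (f : rmap A B) (M : rmod A) : Type := Tensor {
  tobj :> rmod B;
  tmap : forall W, M W -> tobj W;
  tmapP : is_slin f (oT X) tmap;
  tuniv : forall U (N : rmod B) (g : forall W, M W -> N W), is_slin f U g ->
    exists h : forall W, tobj W -> N W,
      [/\ is_hom U h, eq_over U (fun W m => h W (tmap m)) g &
          forall h' : forall W, tobj W -> N W,
            is_hom U h' -> eq_over U (fun W m => h' W (tmap m)) g ->
            eq_over U h' h] }.

(* The map h with h (m ⊗ b) = g(m) b. *)
Definition tlift (A B : rsheaf X) (f : rmap A B) (M : rmod A) (T : tensor f M)
    U (N : rmod B) (g : forall W, M W -> N W) : forall W, T W -> N W :=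
  if pselect (exists h : forall W, T W -> N W,
       is_hom U h /\ eq_over U (fun W m => h W (tmap T m)) g) is left H
  then projT1 (cid H) else fun W _ => 0.

(* Local finite sums of sections satisfying G; the second version is for
   pairs of sections of two sheaves. *)
Definition span (A : rsheaf X) (M : rmod A) (G : forall W, M W -> Prop)
    W (x : M W) : Prop :=
  forall p, W p -> exists Z, [/\ Z p, Z `<=o` W &
    exists2 s : seq (M Z), {in s, forall y, G Z y} &
      mres Z x = \sum_(y <- s) y].

Definition span2 (A B : rsheaf X) (M : rmod A) (N : rmod B)
    (G : forall W, M W -> N W -> Prop) W (x : M W) (y : N W) : Prop :=
  forall p, W p -> exists Z, [/\ Z p, Z `<=o` W &
    exists2 s : seq (M Z * N Z), {in s, forall z, G Z z.1 z.2} &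
      mres Z x = \sum_(z <- s) z.1 /\ mres Z y = \sum_(z <- s) z.2].

(* A subsheaf of abelian groups, over U, of a sheaf F. *)
Definition is_subsheaf U (F : open -> zmodType) (r : forall W Z, F W -> F Z)
    (P : forall W, F W -> Prop) : Prop :=
  forall W, W `<=o` U ->
    [/\ P W 0, forall s t, P W s -> P W t -> P W (s - t),
        forall Z s, Z `<=o` W -> P W s -> P Z (r W Z s) &
        forall s, (forall p, W p ->
          exists Z, [/\ Z p, Z `<=o` W & P Z (r W Z s)]) -> P W s].

(* An increasing exhaustive filtration, over U, by subsheaves. *)
Definition is_filtration U (F : open -> zmodType) (r : forall W Z, F W -> F Z)
    (P : int -> forall W, F W -> Prop) : Prop :=
  [/\ forall k, is_subsheaf U r (P k),
      forall k l W s, W `<=o` U -> k <= l -> P k W s -> P l W s &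
      forall W s, W `<=o` U -> forall p, W p ->
        exists Z k, [/\ Z p, Z `<=o` W & P k Z (r W Z s)]].

(* [G] is the graph of an isomorphism P / P' -> Q / Q' of quotient sheaves over
   U, where P' is a subsheaf of P and Q' a subsheaf of Q: [G W s t] means that
   the class of s is sent to the class of t. *)
Definition quotient_iso U (F F' : open -> zmodType)
    (r : forall W Z, F W -> F Z) (r' : forall W Z, F' W -> F' Z)
    (P P' : forall W, F W -> Prop) (Q Q' : forall W, F' W -> Prop)
    (G : forall W, F W -> F' W -> Prop) : Prop :=
  forall W, W `<=o` U ->
    (forall s t, G W s t -> P W s /\ Q W t) /\
    [/\ forall s t s' t', G W s t -> G W s' t' -> G W (s - s') (t - t'),
        forall Z s t, Z `<=o` W -> G W s t -> G Z (r W Z s) (r' W Z t),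
        forall s t, (forall p, W p -> exists Z,
          [/\ Z p, Z `<=o` W & G Z (r W Z s) (r' W Z t)]) -> G W s t,
        forall s t, P' W s -> Q' W t -> G W s t &
        forall s t, G W s t -> (P' W s <-> Q' W t)] /\
    (forall s, P W s -> forall p, W p -> exists Z t,
       [/\ Z p, Z `<=o` W & G Z (r W Z s) t]) /\
    (forall t, Q W t -> forall p, W p -> exists Z s,
       [/\ Z p, Z `<=o` W & G Z s (r' W Z t)]).

End Modules.

Arguments is_slin {R n X A B} f U {M N} h.
Arguments is_hom {R n X A} U {M N} h.
Arguments is_iso {R n X A} U {M N} h.
Arguments are_inverse {R n X A} U {M N} h g.
Arguments tmap {R n X A B f M} t {W}.
Arguments rfree {R n X} A r.

(* Powers of an invertible element x with inverse y. *)
Definition zpow (A : pzRingType) (x y : A) (k : int) : A :=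
  match k with Posz m => x ^+ m | Negz m => y ^+ m.+1 end.

(** * Microdifferential operators *)

Section Micro.
Variables (R : realType) (X : dcurve R).
Local Notation open := (open X).
Implicit Types U W Z : open.

(* [d] freely generates the vector fields on W as an O-module. *)
Definition is_frame W (d : Dsh X W) : Prop :=
  vector_field (dval d) /\
  forall Z, Z `<=o` W -> forall P : endo Z, vector_field P ->
    exists! f : Osh X Z, P = mulop f * endo_res Z (dval d).

(* The sheaf of microdifferential operators, characterised locally: it is a
   filtered overring of D which, near every point, consists of the formal
   series  sum_{N <= k} a_N d^N  in a local generator d of the vector fields.
   The multiplication is determined by that of D, the inverse of d and
   continuity; in particular the rule for d^N f follows for all integers N
   from d f = f d + d(f). *)
Record microdiff : Type := MicroDiff {
  Esh :> rsheaf X;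
  D2E : rmap (Dsh X) Esh;
  Efil : int -> forall W, Esh W -> Prop;
  Efil_filtration : is_filtration (oT X) (@rres _ _ _ Esh) Efil;
  Efil_mul : forall k l W (P Q : Esh W),
    Efil k P -> Efil l Q -> Efil (k + l) (P * Q);
  Efil_D2E : forall k W (P : Dsh X W), Dfil k P -> Efil k (D2E W P);
  E_series : forall p, dc_pts X p -> exists W, exists (d : Dsh X W) (d' : Esh W),
    [/\ W p, is_frame d, D2E W d * d' = 1 /\ d' * D2E W d = 1 &
      forall Z, Z `<=o` W -> forall k : int,
      let expands (a : nat -> Osh X Z) (P : Esh Z) : Prop :=
        forall m : nat, Efil (k - m%:Z)
          (P - \sum_(i < m) D2E Z (O2D X Z (a i)) *
             zpow (rres Z (D2E W d)) (rres Z d') (k - i%:Z)) in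
      (forall a, exists! P, expands a P) /\
      (forall P, Efil k P -> exists! a, expands a P)] }.

End Micro.

(** * Framed D-bundles, micro-opers and Lax operators *)

Section MicroOpers.
Variables (R : realType) (X : dcurve R) (E : microdiff X).
Local Notation open := (open X).
Local Notation O := (Osh X).
Local Notation D := (Dsh X).
Implicit Types U W Z : open.

Definition O2E : rmap O E := rcomp (O2D X) (D2E E).

Definition is_vector_bundle (r : nat) (V : rmod O) : Prop :=
  forall p, dc_pts X p -> exists W (h : forall Z, rfree O r Z -> V Z), W p /\ is_iso W h.

(* A subsheaf of O-modules of M has generic rank r: over some nonempty open set
   it is free of rank r. (U is irreducible.) *)
Definition has_rank U (M : rmod O) (P : forall W, M W -> Prop) (r : nat) : Prop :=
  oset U !=set0 ->
  exists W, [/\ W `<=o` U, oset W !=set0 &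
    exists e : 'I_r -> M W, (forall i, P W (e i)) /\
      forall Z, Z `<=o` W -> forall m : M Z, P Z m ->
        exists! c : {ffun 'I_r -> O Z}, m = \sum_i mres Z (e i) *a c i].

(* Locally projective coherent: locally a direct summand of some D^N. *)
Definition is_Dbundle U (M : rmod D) : Prop :=
  (forall p, U p -> exists W N, exists (i : forall Z, M Z -> rfree D N Z)
      (q : forall Z, rfree D N Z -> M Z),
    [/\ W p, W `<=o` U, is_hom W i, is_hom W q &
        eq_over W (fun Z m => q Z (i Z m)) (fun Z m => m)]) /\
  (forall p, U p -> ~ smooth_at X p ->
    exists W N, exists h : forall Z, rfree D N Z -> M Z,
      [/\ W p, W `<=o` U & is_iso W h]).

Section Framed.
Variables (V : rmod O) (VD : tensor (O2D X) V) (VE : tensor O2E V).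

(* V ⊗ D_k as a subsheaf of V ⊗ D, and V ⊗ E_k as a subsheaf of V ⊗ E. *)
Definition VDfil (k : int) : forall W, VD W -> Prop :=
  span (fun W x => exists v d, Dfil k d /\ x = tmap VD v *a d).

Definition VEfil (k : int) : forall W, VE W -> Prop :=
  span (fun W x => exists v e, Efil k e /\ x = tmap VE v *a e).

(* The canonical map V ⊗ D -> V ⊗ E. *)
Definition VD2VE : forall W, VD W -> VE W :=
  @tlift _ _ _ _ _ _ _ VD (oT X) (rrestr (D2E E) VE) (fun W v => tmap VE v).

(* The data of a framing: [fgr k] is the graph of the isomorphism
   gr_k(M) -> V ⊗ gr_k(D) = gr_k(V ⊗ D), for k >= fk0. *)
Record framed : Type := Framed {
  fmod :> rmod D;
  ffil : int -> forall W, fmod W -> Prop;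
  fk0 : int;
  fgr : int -> forall W, fmod W -> VD W -> Prop }.

(* A trivialization of M over U as a V-framed D-bundle. As in the definition
   of framings, only large filtration degrees matter. *)
Definition framed_triv U (M : framed) (phi : forall W, M W -> VD W) : Prop :=
  is_iso U phi /\
  forall k, fk0 M <= k -> forall W, W `<=o` U -> forall m : M W,
    (ffil k m <-> VDfil k (phi W m)) /\ (ffil k m -> fgr k m (phi W m)).

Definition framed_iso U (M N : framed) (f : forall W, M W -> N W) : Prop :=
  is_iso U f /\
  forall k, fk0 M <= k -> fk0 N <= k -> forall W, W `<=o` U -> forall m : M W,
    (ffil k m <-> ffil k (f W m)) /\
    forall x, fgr k m x <-> fgr k (f W m) x.

(* M_{E,k} = \bigcup_n M_{k+n} E_{-n}, inside M_E = M ⊗_D E. *)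
Definition MEfil (M : framed) (ME : tensor (D2E E) M) (k : int) :
    forall W, ME W -> Prop :=
  span (fun W x => exists (j : nat) m e,
    [/\ ffil (k + j%:Z) m, Efil (- j%:Z) e & x = tmap ME m *a e]).

(* The graph of the isomorphism gr_k(M_E) -> V ⊗ gr_k(E) induced by the
   framing: [m] e is sent to fgr(m) e. *)
Definition MEgr (M : framed) (ME : tensor (D2E E) M) (k : int) :
    forall W, ME W -> VE W -> Prop :=
  span2 (fun W x y =>
    (exists l m z e, [/\ fk0 M <= l, fgr l m z, Efil (k - l) e &
       x = tmap ME m *a e /\ y = VD2VE z *a e]) \/
    (MEfil (k - 1) x /\ VEfil (k - 1) y)).

Definition is_framed (r : nat) U (M : framed) (ME : tensor (D2E E) M) : Prop :=
  is_Dbundle U M /\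
  is_filtration U (@mres _ _ _ _ M) (@ffil M) /\
  (forall k l W (m : M W) (d : D W), W `<=o` U ->
     ffil k m -> Dfil l d -> ffil (k + l) (m *a d)) /\
  (forall k, fk0 M <= k ->
     quotient_iso U (@mres _ _ _ _ M) (@mres _ _ _ _ VD)
       (@ffil M k) (@ffil M (k - 1)) (VDfil k) (VDfil (k - 1)) (@fgr M k)) /\
  (forall k l W (m : M W) (z : VD W) (d : D W), W `<=o` U ->
     fk0 M <= k -> 0 <= l -> fgr k m z -> Dfil l d ->
     fgr (k + l) (m *a d) (z *a d)) /\
  (forall p, U p -> ~ smooth_at X p -> exists W (phi : forall Z, M Z -> VD Z),
     [/\ W p, W `<=o` U & framed_triv W phi]) /\
  (forall k : int,
     has_rank U (M := rrestr (O2D X) M) (fun W m => MEfil (M := M) k (tmap ME m))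
       (match k with Posz k => k.+1 * r | Negz _ => 0 end)%N).

(* The operator e |-> ∂ e on E. *)
Definition vfE W (e : E W) : E W := D2E E W (rres W (Dvf X)) * e.

(* For the symbol condition: gr_k(M_E) is locally generated by classes sent to
   v ⊗ e, and Id ⊗ ∂ sends v ⊗ e to v ⊗ ∂ e. *)
Definition is_micro_oper U (M : framed) (ME : tensor (D2E E) M)
    (dM : forall W, ME W -> ME W) : Prop :=
  [/\ is_hom U dM,
      forall k W (x : ME W), W `<=o` U -> MEfil k x -> MEfil (k + 1) (dM W x) &
      forall k W (x : ME W) (v : V W) (e : E W), W `<=o` U ->
        MEfil k x -> Efil k e -> MEgr k x (tmap VE v *a e) ->
        MEgr (k + 1) (dM W x) (tmap VE v *a vfE e)].

Definition is_Lax U (L : forall W, VE W -> VE W) : Prop :=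
  [/\ is_hom U L,
      forall k W (x : VE W), W `<=o` U -> VEfil k x -> VEfil (k + 1) (L W x) &
      forall k W (v : V W) (e : E W), W `<=o` U -> Efil k e ->
        VEfil k (L W (tmap VE v *a e) - tmap VE v *a vfE e)].

Definition triv_set (M : framed) : set (proj R (dc_dim X)) :=
  [set p | exists W (phi : forall Z, M Z -> VD Z), W p /\ framed_triv W phi].

Lemma triv_set_open (M : framed) : triv_set M `<=` X /\
  exists2 A : set (proj R (dc_dim X)), zopen A & triv_set M = dc_pts X `&` A.
Proof.
apply: open_union_prop.
  by move=> p [W [phi [Wp _]]]; apply: open_subT Wp.
move=> p [W [phi [Wp tphi]]]; exists W => // q Wq.
by exists W, phi.
Qed.

(* The largest open set over which M is locally, hence (trivializations being
   unique) globally, trivial as a V-framed D-bundle. *)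
Definition triv_locus (M : framed) : open := Open (triv_set_open M).

(* The isomorphism M_E -> V ⊗ E over U induced by phi : M -> V ⊗ D. *)
Definition triv_E U (M : framed) (ME : tensor (D2E E) M)
    (phi : forall W, M W -> VD W) : forall W, ME W -> VE W :=
  tlift (T := ME) U (fun W m => VD2VE (phi W m)).

Arguments triv_E : clear implicits.

(* L is the operator dM read through the trivialization phi. *)
Definition corresponds U (M : framed) (ME : tensor (D2E E) M)
    (phi : forall W, M W -> VD W) (dM : forall W, ME W -> ME W)
    (L : forall W, VE W -> VE W) : Prop :=
  eq_over U (fun W x => triv_E U M ME phi W (dM W x)) (fun W x => L W (triv_E U M ME phi W x)).

(* The operators dM and dN correspond under f : M -> N. *)
Definition intertwines U (M N : framed) (ME : tensor (D2E E) M)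
    (NE : tensor (D2E E) N) (f : forall W, M W -> N W)
    (dM : forall W, ME W -> ME W) (dN : forall W, NE W -> NE W) : Prop :=
  let fE := tlift (T := ME) U (fun W m => tmap NE (f W m)) in
  eq_over U (fun W x => fE W (dM W x)) (fun W x => dN W (fE W x)).

End Framed.
End MicroOpers.

Arguments triv_E {R X E V VD} VE U {M} ME phi W _.

(* Main.v *)
Require Import Defs.
From mathcomp Require Import all_boot all_order all_algebra reals.
From mathcomp Require Import boolp classical_sets.
Import Defs.

Set Implicit Arguments.
Unset Strict Implicit.
Unset Printing Implicit Defensive.

Import GRing.Theory Num.Theory Order.TTheory.
Local Open Scope classical_set_scope.
Local Open Scope ring_scope.

(** A trivialization [phi : M -> V ⊗ D] induces [tE : M_E -> V ⊗ E], and the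
    correspondence is conjugation by [tE]: the micro-oper [dM] goes to
    [tE dM tE^-1], and a Lax operator [L] comes from [tE^-1 L tE]. Four points
    make this work.

    Uniqueness of [phi]. Two trivializations differ by an endomorphism [h] of
    V ⊗ D which lowers the order in all large degrees. For a local generator
    [d] of the vector fields and [n] large, [h (v ⊗ 1) d^n = h (v ⊗ d^n)] then
    has order less than [n], and right multiplication by [d^n] shifts orders by
    exactly [n], so [h (v ⊗ 1)] has negative order and vanishes ([rigidity]).
    The shift of orders is read off in E, where [d] is invertible and where
    the uniqueness of expansions in powers of [d] shows that D meets the
    operators of negative order trivially ([chart_exists]).

    Existence of [phi] over the whole trivial locus: by uniqueness, the local
    trivializations agree on overlaps and glue ([triv_exists]).

    Invertibility of [tE] is formal: both sides are extensions of scalars of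
    isomorphic modules ([triv_E_iso]).

    Compatibility with filtrations and symbols. The framing controls M only in
    large degrees, but over E one can always move there: a section [m] may be
    replaced by [m d^n], and [v ⊗ e] is [(v ⊗ d^n) d^-n e]. Hence the filtration
    of M_E corresponds to that of V ⊗ E ([MEfil_triv], [triv_E_onto]), and the
    graph of the isomorphism of graded sheaves is the graph of [tE] modulo lower
    order ([MEgr_triv]). The conditions defining micro-opers and Lax operators
    thereby become the same ([micro_oper_Lax], [Lax_micro_oper]).

    Finally two micro-opers with the same Lax operator are identified by
    [psi^-1 phi], which is the only framed isomorphism by uniqueness of
    trivializations again ([framed_iso_unique]). *)

(** * Semilinear maps, tensor products, spans *)

Section Generalities.
Variables (R : realType) (n : nat) (X : set (proj R n)).
Local Notation open := (open X).
Implicit Types U W Z : open.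

Lemma oIl U W : oI U W `<=o` U.
Proof. by move=> ? []. Qed.

Lemma oIr U W : oI U W `<=o` W.
Proof. by move=> ? []. Qed.

Section Rings.
Variables (A B : rsheaf X) (f : rmap A B).

Lemma rmap0 W : f W 0 = 0.
Proof. by apply: (addrI (f W 0)); rewrite -rmapD !addr0. Qed.

Lemma rmapN W : {morph f W : a / - a}.
Proof. by move=> a; apply: (addrI (f W a)); rewrite -rmapD !subrr rmap0. Qed.

Lemma rmapB W : {morph f W : a b / a - b}.
Proof. by move=> a b; rewrite rmapD rmapN. Qed.

Lemma rmapX W k : {morph f W : a / a ^+ k}.
Proof.
by move=> a; elim: k => [|k IH]; rewrite ?rmap1// !exprS rmapM IH.
Qed.

Lemma rres0 W Z : Z `<=o` W -> rres Z (0 : A W) = 0.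
Proof. exact: (is_sheaf_res0 (rsheafP A)). Qed.

Lemma rres_comp W Z Y (a : A W) : Z `<=o` W -> Y `<=o` Z ->
  rres Y (rres Z a) = rres Y a.
Proof. by move=> ZW YZ; rewrite (sh_comp (rsheafP A)). Qed.

End Rings.

Section Slin.
Variables (A B : rsheaf X) (f : rmap A B) (U : open) (M : rmod A) (N : rmod B).
Variables (h : forall W, M W -> N W) (hh : is_slin f U h).
Arguments h : clear implicits.

Lemma slinD W : W `<=o` U -> {morph h W : x y / x + y}.
Proof. by move=> /hh []. Qed.

Lemma slinA W : W `<=o` U -> forall m a, h W (m *a a) = h W m *a f W a.
Proof. by move=> /hh []. Qed.

Lemma slin_res W Z : W `<=o` U -> Z `<=o` W ->
  forall m, h Z (mres Z m) = mres Z (h W m).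
Proof. by move=> /hh [_ _]; apply. Qed.

Lemma slin0 W : W `<=o` U -> h W 0 = 0.
Proof. by move=> WU; apply: (addrI (h W 0)); rewrite -slinD// !addr0. Qed.

Lemma slinN W : W `<=o` U -> {morph h W : x / - x}.
Proof.
by move=> WU x; apply: (addrI (h W x)); rewrite -slinD// !subrr slin0.
Qed.

Lemma slinB W : W `<=o` U -> {morph h W : x y / x - y}.
Proof. by move=> WU x y; rewrite slinD// slinN. Qed.

End Slin.

Lemma slin_sub (A B : rsheaf X) (f : rmap A B) U U' (M : rmod A) (N : rmod B)
    (h : forall W, M W -> N W) :
  U' `<=o` U -> is_slin f U h -> is_slin f U' h.
Proof. by move=> U'U hh W WU'; apply: hh; apply: subset_trans U'U. Qed.

Lemma slin_comp (A B C : rsheaf X) (f : rmap A B) (f' : rmap B C) U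
    (M : rmod A) (N : rmod B) (P : rmod C)
    (h : forall W, M W -> N W) (k : forall W, N W -> P W) :
  is_slin f U h -> is_slin f' U k ->
  is_slin (rcomp f f') U (fun W m => k W (h W m)).
Proof.
move=> hh hk W WU; split=> [m m'|m a|Z ZW m].
- by rewrite (slinD hh)// (slinD hk).
- by rewrite (slinA hh)// (slinA hk).
- by rewrite (slin_res hh WU)// (slin_res hk WU).
Qed.

Lemma hom_comp (A : rsheaf X) U (M N P : rmod A)
    (h : forall W, M W -> N W) (k : forall W, N W -> P W) :
  is_hom U h -> is_hom U k -> is_hom U (fun W m => k W (h W m)).
Proof. by move=> hh hk; exact: (slin_comp hh hk). Qed.

Lemma id_hom (A : rsheaf X) U (M : rmod A) : is_hom U (fun W (m : M W) => m).
Proof. by split. Qed.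

Lemma mact0l (A : rsheaf X) (M : rmod A) W (a : A W) : (0 : M W) *a a = 0.
Proof. by apply: (addrI (0 *a a)); rewrite -mactDl !addr0. Qed.

Lemma mactNl (A : rsheaf X) (M : rmod A) W (m : M W) (a : A W) :
  (- m) *a a = - (m *a a).
Proof. by apply: (addrI (m *a a)); rewrite -mactDl !subrr mact0l. Qed.

Lemma mres0 (A : rsheaf X) (M : rmod A) W Z : Z `<=o` W ->
  mres Z (0 : M W) = 0.
Proof. exact: (is_sheaf_res0 (rmodP M)). Qed.

Lemma mresD (A : rsheaf X) (M : rmod A) W Z : Z `<=o` W ->
  {morph @mres _ _ _ _ M W Z : x y / x + y}.
Proof. by move=> ZW x y; rewrite (sh_add (rmodP M)). Qed.

Lemma mresN (A : rsheaf X) (M : rmod A) W Z : Z `<=o` W ->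
  {morph @mres _ _ _ _ M W Z : x / - x}.
Proof.
by move=> ZW x; apply: (addrI (mres Z x)); rewrite -mresD// !subrr mres0.
Qed.

Lemma mresB (A : rsheaf X) (M : rmod A) W Z : Z `<=o` W ->
  {morph @mres _ _ _ _ M W Z : x y / x - y}.
Proof. by move=> ZW x y; rewrite mresD// mresN. Qed.

Lemma mres_comp (A : rsheaf X) (M : rmod A) W Z Y (m : M W) :
  Z `<=o` W -> Y `<=o` Z -> mres Y (mres Z m) = mres Y m.
Proof. by move=> ZW YZ; rewrite (sh_comp (rmodP M)). Qed.

Lemma zero_hom (A : rsheaf X) U (M N : rmod A) :
  is_hom U (fun W (_ : M W) => 0 : N W).
Proof.
move=> W WU; split=> [m m'|m a|Z ZW m]; first by rewrite addr0.
  by rewrite mact0l.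
by rewrite mres0.
Qed.

Lemma hom_sub (A : rsheaf X) U (M N : rmod A) (h k : forall W, M W -> N W) :
  is_hom U h -> is_hom U k -> is_hom U (fun W m => h W m - k W m).
Proof.
move=> hh hk W WU; split=> [m m'|m a|Z ZW m].
- by rewrite (slinD hh WU) (slinD hk WU) opprD addrACA.
- by rewrite (slinA hh WU) (slinA hk WU) mactDl mactNl.
- by rewrite (slin_res hh WU)// (slin_res hk WU)// mresB.
Qed.

Lemma is_iso_sub (A : rsheaf X) U U' (M N : rmod A) (h : forall W, M W -> N W) :
  U' `<=o` U -> is_iso U h -> is_iso U' h.
Proof.
move=> U'U [hh [g hg [gh hgE]]]; split; first exact: slin_sub hh.
exists g; first exact: slin_sub hg.
by split=> W WU'; [apply: gh|apply: hgE]; apply: subset_trans U'U.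
Qed.

Section Tensor.
Variables (A B : rsheaf X) (f : rmap A B) (M : rmod A) (T : tensor f M).

Lemma tliftP U (N : rmod B) (g : forall W, M W -> N W) : is_slin f U g ->
  is_hom U (tlift (T := T) U g) /\
  forall W, W `<=o` U -> forall m, tlift (T := T) U g (tmap T m) = g W m.
Proof.
move=> hg; rewrite /tlift; case: pselect => [H|[]].
  by case: (cid H) => h [].
by have [h [? ? _]] := tuniv T hg; exists h.
Qed.

Lemma tensor_ext U (N : rmod B) (h h' : forall W, T W -> N W) :
  is_hom U h -> is_hom U h' ->
  eq_over U (fun W m => h W (tmap T m)) (fun W m => h' W (tmap T m)) ->
  eq_over U h h'.
Proof.
move=> hh hh' E.
have ht : is_slin f U (@tmap _ _ _ _ _ _ _ T).
  exact: slin_sub (@open_subT _ _ _ U) (tmapP T).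
have [k [_ _ ku]] := tuniv T (slin_comp ht hh').
move=> W WU x; rewrite (ku h hh _ W WU)// (ku h' hh' _ W WU)//.
Qed.

End Tensor.

(** What passes from generators to a span. Stability under multiplication by a
    scalar [e] is of this kind but is not a subsheaf condition when [e] ranges
    over the scalars of the open set at hand, since those of a smaller open set
    need not extend; this is why restriction to smaller open sets is absent. *)
Definition local_additive U (F : open -> zmodType)
    (r : forall W Z, F W -> F Z) (P : forall W, F W -> Prop) : Prop :=
  forall W, W `<=o` U ->
    [/\ P W 0, forall s t, P W s -> P W t -> P W (s + t) &
        forall s, (forall p, W p ->
          exists Z, [/\ Z p, Z `<=o` W & P Z (r W Z s)]) -> P W s].

Definition res_stable U (F : open -> zmodType)
    (r : forall W Z, F W -> F Z) (P : forall W, F W -> Prop) : Prop :=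
  forall W Z s, W `<=o` U -> Z `<=o` W -> P W s -> P Z (r W Z s).

Lemma subsheaf_additive U (F : open -> zmodType)
    (r : forall W Z, F W -> F Z) (P : forall W, F W -> Prop) :
  is_subsheaf U r P -> local_additive U r P.
Proof.
move=> hP W WU; have [P0 PB _ Pl] := hP W WU; split=> // s t Ps Pt.
by rewrite -[t]opprK -[- t]sub0r; apply: (PB) => //; apply: PB.
Qed.

Lemma slin_additive (A B : rsheaf X) (f : rmap A B) U (M : rmod A) (N : rmod B)
    (h : forall W, M W -> N W) (P : forall W, N W -> Prop) :
  is_slin f U h -> local_additive U (@mres _ _ _ _ N) P ->
  local_additive U (@mres _ _ _ _ M) (fun W m => P W (h W m)).
Proof.
move=> hh hP W WU; have [P0 PD Pl] := hP W WU; split=> [|s t Ps Pt|s Ps].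
- by rewrite (slin0 hh).
- by rewrite (slinD hh WU); apply: PD.
apply: Pl => p Wp; have [Z [Zp ZW PZ]] := Ps p Wp.
by exists Z; split=> //; rewrite -(slin_res hh WU).
Qed.

Lemma local_additive_sub U U' (F : open -> zmodType)
    (r : forall W Z, F W -> F Z) (P : forall W, F W -> Prop) :
  U' `<=o` U -> local_additive U r P -> local_additive U' r P.
Proof. by move=> U'U hP W WU'; apply: hP; apply: subset_trans U'U. Qed.

Section Span.
Variables (A : rsheaf X) (M : rmod A) (G : forall W, M W -> Prop).
Arguments G : clear implicits.

Lemma span_min U (P : forall W, M W -> Prop) :
  local_additive U (@mres _ _ _ _ M) P ->
  (forall W x, W `<=o` U -> G W x -> P W x) ->
  forall W (x : M W), W `<=o` U -> span G x -> P W x.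
Proof.
move=> hP GP W x WU sx; have [_ _ Pl] := hP W WU; apply: Pl => p Wp.
have [Z [Zp ZW [s sG E]]] := sx p Wp; exists Z; split=> //; rewrite {}E.
have ZU := subset_trans ZW WU; have [P0 PD _] := hP Z ZU.
elim: s sG => [|y s IH] sG; first by rewrite big_nil.
rewrite big_cons; apply: PD; first by apply: GP => //; apply: sG; rewrite mem_head.
by apply: IH => z zs; apply: sG; rewrite inE zs orbT.
Qed.

Lemma span_gen W (x : M W) : G W x -> span G x.
Proof.
move=> Gx p Wp; exists W; split=> //; exists [:: x].
  by move=> y; rewrite inE => /eqP->.
by rewrite big_seq1 (sh_id (rmodP M)).
Qed.

Lemma span_local W (x : M W) : (forall p, W p ->
  exists Z, [/\ Z p, Z `<=o` W & span G (mres Z x)]) -> span G x.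
Proof.
move=> H p Wp; have [Z [Zp ZW sx]] := H p Wp.
have [Y [Yp YZ [s sG E]]] := sx p Zp.
exists Y; split=> //; first exact: subset_trans ZW.
by exists s; rewrite // -E mres_comp.
Qed.

Variables (U : open) (Gres : res_stable U (@mres _ _ _ _ M) G).

Lemma span_additive : local_additive U (@mres _ _ _ _ M) (@span _ _ _ _ _ G).
Proof.
move=> W WU; split=> [p Wp|x y sx sy p Wp|x]; last exact: span_local.
  by exists W; split=> //; exists [::]; rewrite // big_nil mres0.
have [Z [Zp ZW [s sG Es]]] := sx p Wp; have [Y [Yp YW [t tG Et]]] := sy p Wp.
have ZI := @oIl Z Y; have YI := @oIr Z Y.
exists (oI Z Y); split=> //; first exact: subset_trans ZW.
exists (map (mres (oI Z Y)) s ++ map (mres (oI Z Y)) t).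
  move=> z; rewrite mem_cat => /orP[] /mapP[w ws ->].
    by apply: (Gres (subset_trans ZW WU)) => //; apply: sG.
  by apply: (Gres (subset_trans YW WU)) => //; apply: tG.
have mS V (VI : oI Z Y `<=o` V) (u : seq (M V)) :
    mres (oI Z Y) (\sum_(w <- u) w) = \sum_(w <- u) mres (oI Z Y) w.
  elim: u => [|w u IH]; first by rewrite !big_nil mres0.
  by rewrite !big_cons mresD// IH.
rewrite big_cat !big_map /= -!mS// -Es -Et mresD; last exact: subset_trans ZW.
by rewrite !mres_comp.
Qed.

Lemma span_res : res_stable U (@mres _ _ _ _ M) (@span _ _ _ _ _ G).
Proof.
move=> W Z x WU ZW; move: W x WU Z ZW.
pose P W (x : M W) := forall Z, Z `<=o` W -> span G (mres Z x).
suff H W (x : M W) : W `<=o` U -> span G x -> P W x.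
  by move=> W x WU Z ZW sx; apply: H.
apply: span_min W x => [W WU|W y WU Gy Z ZW]; last first.
  by apply: span_gen; apply: Gres Gy.
split=> [Z ZW|s t Ps Pt Z ZW|s Ps Z ZW].
- by rewrite mres0//; have [] := span_additive (subset_trans ZW WU).
- rewrite mresD//; have [_ sD _] := span_additive (subset_trans ZW WU).
  by apply: sD; [apply: Ps|apply: Pt].
apply: span_local => p Zp; have [Y [Yp YW PY]] := Ps p (ZW p Zp).
exists (oI Z Y); split=> //; first exact: oIl.
rewrite mres_comp//; last exact: oIl.
by rewrite -(mres_comp s YW (@oIr Z Y)); apply: PY; exact: oIr.
Qed.

Lemma span_opp : (forall W x, W `<=o` U -> G W x -> G W (- x)) ->
  forall W (x : M W), W `<=o` U -> span G x -> span G (- x).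
Proof.
move=> GN; apply: span_min => [W WU|W x WU Gx].
  have [s0 sD _] := span_additive WU; split=> [|s t ss st|s ss].
  - by rewrite oppr0.
  - by rewrite opprD; apply: sD.
  - apply: span_local => p Wp; have [Z [Zp ZW sZ]] := ss p Wp.
    by exists Z; split=> //; rewrite mresN.
by apply: span_gen; apply: GN.
Qed.

End Span.

Section Span2.
Variables (A B : rsheaf X) (M : rmod A) (N : rmod B).
Variables (G : forall W, M W -> N W -> Prop) (U : open).
Arguments G : clear implicits.

Lemma span2_gen W (x : M W) (y : N W) : G W x y -> span2 G x y.
Proof.
move=> Gx p Wp; exists W; split=> //; exists [:: (x, y)].
  by move=> z; rewrite inE => /eqP->.
by rewrite !big_seq1 (sh_id (rmodP M)) (sh_id (rmodP N)).
Qed.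

Lemma span2_local W (x : M W) (y : N W) : (forall p, W p -> exists Z,
  [/\ Z p, Z `<=o` W & span2 G (mres Z x) (mres Z y)]) -> span2 G x y.
Proof.
move=> H p Wp; have [Z [Zp ZW sx]] := H p Wp.
have [Y [Yp YZ [s sG [E E']]]] := sx p Zp.
exists Y; split=> //; first exact: subset_trans ZW.
by exists s; rewrite // -E -E' !mres_comp.
Qed.

Lemma span2_0 W : span2 G (0 : M W) (0 : N W).
Proof.
by move=> p Wp; exists W; split=> //; exists [::]; rewrite // !big_nil !mres0.
Qed.

Lemma span2_add : (forall W Z x y, W `<=o` U -> Z `<=o` W ->
    G W x y -> G Z (mres Z x) (mres Z y)) ->
  forall W (x x' : M W) (y y' : N W), W `<=o` U ->
  span2 G x y -> span2 G x' y' -> span2 G (x + x') (y + y').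
Proof.
move=> Gres W x x' y y' WU sx sy p Wp.
have [Z [Zp ZW [s sG [Es Es']]]] := sx p Wp.
have [Y [Yp YW [t tG [Et Et']]]] := sy p Wp.
have ZI := @oIl Z Y; have YI := @oIr Z Y.
exists (oI Z Y); split=> //; first exact: subset_trans ZW.
pose I := oI Z Y.
exists (map (fun z => (mres I z.1, mres I z.2)) s ++
        map (fun z => (mres I z.1, mres I z.2)) t).
  move=> z; rewrite mem_cat => /orP[] /mapP[w ws ->] /=.
    by apply: (Gres _ _ _ _ (subset_trans ZW WU)) => //; apply: sG.
  by apply: (Gres _ _ _ _ (subset_trans YW WU)) => //; apply: tG.
have mS (C : rsheaf X) (L : rmod C) (V : open) (VI : I `<=o` V) T
    (g : T -> L V) (u : seq T) :
    mres I (\sum_(w <- u) g w) = \sum_(w <- u) mres I (g w).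
  elim: u => [|w u IH]; first by rewrite !big_nil mres0.
  by rewrite !big_cons mresD// IH.
have IW : I `<=o` W by exact: subset_trans ZW.
by rewrite !big_cat !big_map /= -!mS// -Es -Et -Es' -Et' !mresD// !mres_comp.
Qed.

Lemma span2_min (P : forall W, M W -> N W -> Prop) :
  (forall W, W `<=o` U ->
    [/\ P W 0 0,
        forall x y x' y', P W x y -> P W x' y' -> P W (x + x') (y + y') &
        forall x y, (forall p, W p -> exists Z,
          [/\ Z p, Z `<=o` W & P Z (mres Z x) (mres Z y)]) -> P W x y]) ->
  (forall W x y, W `<=o` U -> G W x y -> P W x y) ->
  forall W (x : M W) (y : N W), W `<=o` U -> span2 G x y -> P W x y.
Proof.
move=> hP GP W x y WU sx; have [_ _ Pl] := hP W WU; apply: Pl => p Wp.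
have [Z [Zp ZW [s sG [E E']]]] := sx p Wp; exists Z; split=> //.
rewrite {}E {}E'.
have ZU := subset_trans ZW WU; have [P0 PD _] := hP Z ZU.
elim: s sG => [|z s IH] sG; first by rewrite !big_nil.
rewrite !big_cons; apply: PD; first by apply: GP => //; apply: sG; rewrite mem_head.
by apply: IH => w ws; apply: sG; rewrite inE ws orbT.
Qed.

End Span2.

(** * Gluing morphisms *)

Section Gluing.
Variables (A : rsheaf X) (U : open) (M N : rmod A).

(** [C] is a predicate and not a function of the open set: the local morphisms
    come from existence statements, and one open set may carry several. *)
Lemma hom_glue (C : forall W, (forall Z, M Z -> N Z) -> Prop) :
  (forall W h, C W h -> is_hom W h) ->
  (forall p, U p -> exists W h, W p /\ C W h) ->
  (forall W W' Z h h', C W h -> C W' h' -> Z `<=o` W -> Z `<=o` W' ->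
     eq_over Z h h') ->
  exists2 h, is_hom U h & forall W h', W `<=o` U -> C W h' -> eq_over W h h'.
Proof.
move=> Chom Ccov Ccomp.
have exY Y (m : M Y) : exists t : N Y, forall W h, C W h -> Y `<=o` W -> t = h Y m.
  have [[W [h [CW YW]]]|nC] := pselect (exists W h, C W h /\ Y `<=o` W).
    exists (h Y m) => W' h' CW' YW'; exact: (Ccomp W W' Y).
  by exists 0 => W h CW YW; case: nC; exists W, h.
pose g Y m := projT1 (cid (exY Y m)).
have gE Y m W h : C W h -> Y `<=o` W -> g Y m = h Y m.
  by move=> CW YW; rewrite /g; case: cid => /= t /(_ W h CW YW).
have exZ Z (m : M Z) : exists t : N Z, Z `<=o` U -> forall Y W h, C W h ->
    Y `<=o` W -> Y `<=o` Z -> mres Y t = h Y (mres Y m).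
  have [ZU|nZU] := pselect (Z `<=o` U); last by exists 0.
  pose c (Y : open) := Y `<=o` Z /\ exists W h, C W h /\ Y `<=o` W.
  have [|||t tE] := @sh_glue _ _ _ _ _ (rmodP N) Z c (fun Y => g Y (mres Y m)).
  - by move=> Y [].
  - move=> p Zp; have [W [h [Wp CW]]] := Ccov p (ZU p Zp).
    exists (oI Z W) => //; split; first exact: oIl.
    by exists W, h; split=> //; exact: oIr.
  - move=> Y Y' T [YZ [W [h [CW YW]]]] [Y'Z [W' [h' [CW' YW']]]] TY TY'.
    rewrite (gE _ _ _ _ CW YW) (gE _ _ _ _ CW' YW').
    rewrite -(slin_res (Chom _ _ CW) YW)// -(slin_res (Chom _ _ CW') YW')//.
    rewrite !mres_comp//; by apply: (Ccomp W W' T) => //; [apply: subset_trans YW|apply: subset_trans YW'].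
  exists t => _ Y W h CW YW YZ; rewrite tE; last by split=> //; exists W, h.
  exact: (gE _ _ _ _ CW YW).
pose h Z m := projT1 (cid (exZ Z m)).
have hE Z (ZU : Z `<=o` U) m Y W k : C W k -> Y `<=o` W -> Y `<=o` Z ->
    mres Y (h Z m) = k Y (mres Y m).
  by rewrite /h; case: cid => /= t /(_ ZU); apply.
have sep Z (ZU : Z `<=o` U) (s t : N Z) : (forall Y W k, C W k -> Y `<=o` W ->
    Y `<=o` Z -> mres Y s = mres Y t) -> s = t.
  move=> st; apply: (sh_sep (rmodP N)) => p Zp.
  have [W [k [Wp CW]]] := Ccov p (ZU p Zp).
  exists (oI Z W); split=> //; first exact: oIl.
  by apply: (st _ W k) => //; [exact: oIr|exact: oIl].
exists h => [Z ZU|W k WU CW Z ZW m]; last first.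
  rewrite -[LHS](sh_id (rmodP N)) (hE _ _ _ _ _ _ CW)//; last exact: subset_trans WU.
  by rewrite (sh_id (rmodP M)).
split=> [m m'|m a|Y YZ m].
- apply: (sep _ ZU) => Y W k CW YW YZ.
  by rewrite mresD// !(hE _ _ _ _ _ _ CW)// mresD// (slinD (Chom _ _ CW)).
- apply: (sep _ ZU) => Y W k CW YW YZ.
  by rewrite mact_res// !(hE _ _ _ _ _ _ CW)// mact_res// (slinA (Chom _ _ CW)).
- have YU := subset_trans YZ ZU.
  apply: (sep _ YU) => T W k CW TW TY.
  rewrite mres_comp// !(hE _ _ _ _ _ _ CW)// ?mres_comp//.
  exact: subset_trans YZ.
Qed.

End Gluing.

(** The local inverses are unique, hence glue. *)
Lemma iso_local (A : rsheaf X) (U : open) (M N : rmod A)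
    (h : forall W, M W -> N W) : is_hom U h ->
  (forall p, U p -> exists W, [/\ W p, W `<=o` U & is_iso W h]) -> is_iso U h.
Proof.
move=> hh hloc; split=> //.
pose C W (g : forall Z, N Z -> M Z) :=
  [/\ W `<=o` U, is_hom W g & are_inverse W h g].
have [W g []//|p Up|W W' Z g g'|g hg gE] := @hom_glue A U N M C.
- have [W [Wp WU [_ [g hg ghE]]]] := hloc p Up.
  by exists W, g.
- move=> [WU hg [gh hgE]] [W'U hg' [gh' hgE']] ZW ZW' Y YZ x.
  rewrite -[in RHS](hgE Y (subset_trans YZ ZW) x) gh'//.
  exact: subset_trans ZW'.
exists g => //; split=> W WU x.
  apply: (sh_sep (rmodP M)) => p Wp.
  have [Z [Zp ZU [_ [k hk [kh hkE]]]]] := hloc p (WU p Wp).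
  have IW := @oIl W Z; have IZ := @oIr W Z.
  exists (oI W Z); split=> //.
  by rewrite -(slin_res hg WU)// -(slin_res hh WU)// (gE Z k)// kh.
apply: (sh_sep (rmodP N)) => p Wp.
have [Z [Zp ZU [_ [k hk [kh hkE]]]]] := hloc p (WU p Wp).
have IW := @oIl W Z; have IZ := @oIr W Z.
exists (oI W Z); split=> //.
by rewrite -(slin_res hh WU)// -(slin_res hg WU)// (gE Z k)// hkE.
Qed.

End Generalities.

(** * Local structure of differential and microdifferential operators *)

Section Operators.
Variables (R : realType) (X : dcurve R).
Local Notation open := (open X).
Local Notation O := (Osh X).
Local Notation D := (Dsh X).
Implicit Types U W Z : open.

Lemma dgen_Dfil k W (P : D W) : dgen k (dval P) -> Dfil k P.
Proof. by move=> gP p Wp; exists W; split=> //; rewrite (sh_id (endo_sheaf X)). Qed.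

Lemma Dfil_two (i j k : nat) W (P Q S : D W) :
  (forall Z, Z `<=o` W -> dgen i (endo_res Z (dval P)) ->
     dgen j (endo_res Z (dval Q)) -> dgen k (endo_res Z (dval S))) ->
  Dfil i P -> Dfil j Q -> Dfil k S.
Proof.
move=> H FP FQ p Wp; have [Y [Yp YW gP]] := FP p Wp.
have [Z [Zp ZW gQ]] := FQ p Wp; have IY := @oIl _ _ _ Y Z; have IZ := @oIr _ _ _ Y Z.
exists (oI Y Z); split=> //; first exact: subset_trans YW.
apply: H; first exact: subset_trans YW.
  by rewrite -(sh_comp (endo_sheaf X) YW IY); apply: dgen_res.
by rewrite -(sh_comp (endo_sheaf X) ZW IZ); apply: dgen_res.
Qed.

Lemma Dfil_mul (i j : nat) W (P Q : D W) :
  Dfil i P -> Dfil j Q -> Dfil (i + j)%N (P * Q).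
Proof.
apply: Dfil_two => Z ZW gP gQ.
by rewrite [dval _]/= endo_resM//; apply: dgen_mul.
Qed.

Lemma Dfil_fun W (a : O W) : Dfil 0 (O2D X W a).
Proof. by apply: dgen_Dfil; exact: dgen_fun. Qed.

Lemma Dfil_1 W : Dfil 0 (1 : D W).
Proof. by rewrite -(rmap1 (O2D X)); exact: Dfil_fun. Qed.

Lemma Dfil_exp W (P : D W) (k : nat) : Dfil 1 P -> Dfil k (P ^+ k).
Proof.
move=> FP; elim: k => [|k IH]; first by rewrite expr0; exact: Dfil_1.
by rewrite exprS -add1n; apply: Dfil_mul.
Qed.

Lemma Dfil_fun_mul k W (a : O W) (P : D W) : Dfil k P -> Dfil k (O2D X W a * P).
Proof.
case: k => [k FP|k /= ->]; last by rewrite mulr0.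
by rewrite -[k]add0n; apply: (Dfil_mul (i := 0)) => //; exact: Dfil_fun.
Qed.

Lemma Dfil_res k : res_stable (oT X) (@rres _ _ _ D) (@Dfil _ X k).
Proof.
case: k => [k|k] W Z P _ ZW /=; last by move->; exact: (is_sheaf_res0 (rsheafP D)).
move=> FP p Zp; have [Y [Yp YW gP]] := FP p (ZW p Zp).
have IY := @oIl _ _ _ Y Z; have IZ := @oIr _ _ _ Y Z.
exists (oI Y Z); split=> //; rewrite (sh_comp (endo_sheaf X))//.
by rewrite -(sh_comp (endo_sheaf X) YW IY); apply: dgen_res.
Qed.

Lemma Dfil_additive k : local_additive (oT X) (@rres _ _ _ D) (@Dfil _ X k).
Proof.
case: k => [k|k] W _; last first.
  split=> // [_ _ /= -> ->|s s0]; first by rewrite addr0.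
  apply: (sh_sep (rsheafP D)) => p Wp; have [Z [Zp ZW sZ]] := s0 p Wp.
  by exists Z; split=> //; rewrite (rres0 D ZW).
split.
- apply: dgen_Dfil; rewrite -(subrr (1 : D W)); apply: dgen_add.
    by apply: (@dgen_le _ _ _ 0%N) => //; rewrite -(rmap1 (O2D X)); exact: dgen_fun.
  rewrite -(rmap1 (O2D X)); apply: dgen_opp.
  by apply: (@dgen_le _ _ _ 0%N) => //; exact: dgen_fun.
- move=> P Q; apply: (Dfil_two (i := k) (j := k)) => Z ZW gP gQ.
  by rewrite [dval _]/= (sh_add (endo_sheaf X))//; apply: dgen_add.
move=> P HP p Wp; have [Z [Zp ZW FP]] := HP p Wp.
have [Y [Yp YZ gP]] := FP p Zp; exists Y; split=> //.
  exact: subset_trans ZW.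
by rewrite -(sh_comp (endo_sheaf X) ZW YZ).
Qed.

Section Expansion.
Variables (W : open) (d : D W) (fd : is_frame d).

(** Polynomials in [d] of degree less than [k], with coefficients on the left:
    the shift by one makes [frame_poly 0] the zero operator. *)
Fixpoint frame_poly (k : nat) (P : D W) : Prop :=
  if k is k'.+1 then
    exists (a : O W) (Q : D W), frame_poly k' Q /\ P = O2D X W a * d ^+ k' + Q
  else P = 0.

Lemma frame_polyS k P : frame_poly k P -> frame_poly k.+1 P.
Proof. by move=> FP; exists 0, P; rewrite rmap0 mul0r add0r. Qed.

Lemma frame_poly_le k l P : (k <= l)%N -> frame_poly k P -> frame_poly l P.
Proof.
move=> kl FP; rewrite -(subnKC kl); elim: (l - k)%N => [|m IH].
  by rewrite addn0.
by rewrite addnS; apply: frame_polyS.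
Qed.

Lemma frame_poly0 k : frame_poly k 0.
Proof. by elim: k => [|k IH] //; apply: frame_polyS. Qed.

Lemma frame_polyD k P Q : frame_poly k P -> frame_poly k Q -> frame_poly k (P + Q).
Proof.
elim: k P Q => [|k IH] P Q; first by move=> /= -> ->; rewrite addr0.
move=> [a [P' [FP ->]]] [b [Q' [FQ ->]]]; exists (a + b), (P' + Q').
by split; [exact: IH|rewrite rmapD mulrDl addrACA].
Qed.

Lemma frame_poly_fun_mul k a P : frame_poly k P -> frame_poly k (O2D X W a * P).
Proof.
elim: k P => [|k IH] P; first by move=> /= ->; rewrite mulr0.
move=> [b [Q [FQ ->]]]; exists (a * b), (O2D X W a * Q).
by split; [exact: IH|rewrite mulrDr mulrA rmapM].
Qed.

Lemma vector_field_derivation U (P : endo U) : vector_field P -> is_derivation P.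
Proof.
rewrite /vector_field; case: (dc_cubic X) => // -[f ->].
have [dM dC] := dc_der X.
split=> [Z ZU g h|Z ZU c] /=.
  rewrite !(endo_resE _ (@open_subT _ _ _ U) _ (@open_subT _ _ _ Z)) dM mulrDr.
  by rewrite mulrA mulrCA.
by rewrite (endo_resE _ (@open_subT _ _ _ U) _ (@open_subT _ _ _ Z)) dC mulr0.
Qed.

(** The Leibniz rule, read as a commutation relation. *)
Lemma frame_comm (a : O W) : exists b : O W,
  d * O2D X W a = O2D X W a * d + O2D X W b.
Proof.
have [vd _] := fd; have [dM _] := vector_field_derivation vd.
have WW : W `<=o` W by [].
exists (dval d W WW a); apply: val_inj; apply: endo_eq => Z ZW g /=.
by rewrite dM addrC (endo_nat _ _ ZW).
Qed.

Lemma frame_poly_frame_mul k P : frame_poly k P -> frame_poly k.+1 (d * P).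
Proof.
elim: k P => [|k IH] P; first by move=> ->; exists 0, 0; rewrite rmap0 mul0r mulr0 addr0.
move=> [a [Q [FQ ->]]]; have [b E] := frame_comm a.
exists a, (O2D X W b * d ^+ k + d * Q); split.
  apply: frame_polyD; last exact: IH.
  by exists b, 0; rewrite addr0; split=> //; exact: frame_poly0.
by rewrite mulrDr mulrA E mulrDl -mulrA -exprS addrA.
Qed.

(** The normal form is stable under products because [d] can be moved past
    coefficients at the cost of lower order terms. *)
Lemma frame_poly_mul k l P Q :
  frame_poly k.+1 P -> frame_poly l Q -> frame_poly (k + l)%N (P * Q).
Proof.
move=> FP FQ; elim: k P FP => [|k IH] P [a [P' [FP ->]]].
  rewrite FP addr0 expr0 mulr1; exact: frame_poly_fun_mul.
rewrite mulrDl; apply: frame_polyD; last by apply: frame_polyS; exact: IH.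
rewrite -mulrA; apply: frame_poly_fun_mul.
elim: k.+1 => [|m IHm]; first by rewrite expr0 mul1r.
by rewrite exprS -mulrA; exact: frame_poly_frame_mul.
Qed.

Lemma frame_poly_Dfil k P : frame_poly k.+1 P -> Dfil k P.
Proof.
have Fd : Dfil 1 d by apply: dgen_Dfil; apply: dgen_vf; case: fd.
elim: k P => [|k IH] P [a [Q [FQ ->]]].
  by rewrite FQ addr0 expr0 mulr1; exact: Dfil_fun.
have [_ FD _] := Dfil_additive k.+1 (@open_subT _ _ _ W).
apply: FD; first by apply: Dfil_fun_mul; exact: Dfil_exp.
apply: (Dfil_two (i := k) (j := k)) (IH _ FQ) (IH _ FQ) => Z ZW gQ _.
exact: dgen_le gQ.
Qed.

Lemma dgen_frame_poly k (P : endo W) : dgen k P ->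
  exists2 Q : D W, dval Q = P & frame_poly k.+1 Q.
Proof.
have WW : W `<=o` W by [].
elim=> {k P} [f|P vP|k P Q _ [P' <- FP] _ [Q' <- FQ]
    |k l P Q _ [P' <- FP] _ [Q' <- FQ]|k l P kl _ [P' <- FP]].
- by exists (O2D X W f) => //; exists f, 0; rewrite addr0 expr0 mulr1.
- have [f [/= -> _]] := (proj2 fd) W WW P vP; exists (O2D X W f * d).
    by rewrite (sh_id (endo_sheaf X)).
  by exists f, 0; rewrite addr0 expr1; split=> //; exact: (frame_poly0 1).
- by exists (P' + Q') => //; exact: frame_polyD.
- by exists (P' * Q') => //; rewrite -addnS; exact: frame_poly_mul.
- by exists P' => //; apply: frame_poly_le FP.
Qed.

End Expansion.

Lemma frame_res W Z (d : D W) : Z `<=o` W -> is_frame d -> is_frame (rres Z d).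
Proof.
move=> ZW [vd gen]; split; first exact: vector_field_res.
move=> Y YZ P vP; have [f [/= Ef fu]] := gen Y (subset_trans YZ ZW) P vP.
by exists f; rewrite /= (sh_comp (endo_sheaf X)).
Qed.

Section Microdifferential.
Variable E : microdiff X.

Lemma Efil_additive k : local_additive (oT X) (@rres _ _ _ (Esh E)) (@Efil _ _ E k).
Proof. by apply: subsheaf_additive; have [] := Efil_filtration E. Qed.

Lemma EfilD k W (P Q : Esh E W) : Efil k P -> Efil k Q -> Efil k (P + Q).
Proof. by have [_ + _] := Efil_additive k (@open_subT _ _ _ W); apply. Qed.

Lemma Efil_0 k W : Efil k (0 : Esh E W).
Proof. by have [] := Efil_additive k (@open_subT _ _ _ W). Qed.

Lemma Efil_le k l W (P : Esh E W) : k <= l -> Efil k P -> Efil l P.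
Proof.
by have [_ + _] := Efil_filtration E; apply; exact: open_subT.
Qed.

Lemma Efil_res k : res_stable (oT X) (@rres _ _ _ (Esh E)) (@Efil _ _ E k).
Proof.
move=> W Z P WT ZW; have [+ _ _] := Efil_filtration E.
by move=> /(_ k W WT) [_ _ + _]; apply.
Qed.

Lemma EfilN k W (P : Esh E W) : Efil k P -> Efil k (- P).
Proof.
move=> FP; have [+ _ _] := Efil_filtration E.
move=> /(_ k W (@open_subT _ _ _ W)) [P0 PB _ _].
by rewrite -[- P]sub0r; apply: PB.
Qed.

Lemma EfilB k W (P Q : Esh E W) : Efil k P -> Efil k Q -> Efil k (P - Q).
Proof. by move=> FP FQ; apply: EfilD => //; exact: EfilN. Qed.

Lemma Efil_1 W : Efil 0 (1 : Esh E W).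
Proof. by rewrite -(rmap1 (D2E E)); apply: Efil_D2E; exact: Dfil_1. Qed.

Lemma Efil_exp k (n : nat) W (P : Esh E W) : Efil k P -> Efil (k *+ n) (P ^+ n).
Proof.
move=> FP; elim: n => [|n IH]; first exact: Efil_1.
by rewrite exprS mulrS; apply: Efil_mul.
Qed.

Lemma Efil_expN1 (n : nat) W (P : Esh E W) : Efil (- 1) P -> Efil (- n%:Z) (P ^+ n).
Proof. by move=> /(Efil_exp n); rewrite mulNrn natz. Qed.

Lemma exp_inv (A : pzRingType) (a b : A) n : a * b = 1 -> a ^+ n * b ^+ n = 1.
Proof.
move=> ab; elim: n => [|n IH]; first by rewrite mulr1.
by rewrite exprSr exprS mulrA -[X in X * _]mulrA ab mulr1.
Qed.

(** Right multiplication by [d^n] shifts orders by exactly [n]. The last field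
    is the instance that matters: if [P d^n] has order less than [n] then [P] has
    negative order, so it vanishes. *)
Record symbol_chart W (d : D W) (d' : Esh E W) : Prop := SymbolChart {
  chart_d : Dfil 1 d;
  chart_d' : Efil (- 1) d';
  chart_inv : D2E E W d * d' = 1;
  chart_sep : forall Z, Z `<=o` W -> forall (n : nat) (P : D Z),
    Dfil (n%:Z - 1) (P * rres Z d ^+ n) -> P = 0 }.

Lemma chart_res W Z (d : D W) (d' : Esh E W) : Z `<=o` W ->
  symbol_chart d d' -> symbol_chart (rres Z d) (rres Z d').
Proof.
move=> ZW [Fd Fd' dd' sep]; split.
- exact: (Dfil_res (@open_subT _ _ _ W)).
- exact: (Efil_res (@open_subT _ _ _ W)).
- by rewrite rmap_res// -rresM// dd' rres1.
- by move=> Y YZ n P; rewrite rres_comp//; apply: sep; apply: subset_trans ZW.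
Qed.

Lemma chart_exp W (d : D W) (d' : Esh E W) (n : nat) : symbol_chart d d' ->
  D2E E W (d ^+ n) * d' ^+ n = 1.
Proof. by move=> sd; rewrite rmapX exp_inv//; exact: chart_inv. Qed.

(** A differential operator is a polynomial in the frame [d]. If its order in E is
    negative, its coefficients vanish one after the other from the top, by
    uniqueness of the expansions in E. *)
Lemma chart_exists p : dc_pts X p ->
  exists W (d : D W) (d' : Esh E W), W p /\ symbol_chart d d'.
Proof.
move=> Xp; have [W [d [d' [Wp fd [dd' d'd] ser]]]] := E_series E Xp.
exists W, d, d'; split=> //.
have Fd : Dfil 1 d by apply: dgen_Dfil; apply: dgen_vf; case: fd.
have Fd' : Efil (- 1) d'.
  have [ex _] := ser W (fun=> id) (- 1).
  have [P [PE _]] := ex (fun i => if i == 0%N then 1 else 0).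
  have := PE 0%N; have := PE 1%N; rewrite big_ord0 big_ord1 !subr0 eqxx !rmap1 mul1r.
  rewrite -[zpow _ _ _]/(rres W d' ^+ 1) expr1 (sh_id (rsheafP (Esh E))) => F1 F0.
  rewrite -[d'](subKr P); apply: EfilB => //; exact: Efil_le F1.
(* [a d^k] has the expansion (a, 0, 0, ...) in degree k; if its order is less
   than k it also has one beginning with 0, obtained by shifting its expansion
   in degree k - 1. *)
have lead Z (ZW : Z `<=o` W) (k : nat) (a : O Z) :
    Efil (k%:Z - 1) (D2E E Z (O2D X Z a * rres Z d ^+ k)) -> a = 0.
  set P := D2E E Z _ => FP.
  have [_ /(_ P FP) [b [bE _]]] := ser Z ZW (k%:Z - 1).
  have Pk : Efil k P by apply: Efil_le FP; rewrite gerBl.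
  have [_ /(_ P Pk) [c [_ cu]]] := ser Z ZW k.
  pose a1 i := if i is 0%N then a else 0.
  pose a2 i := if i is i'.+1 then b i' else 0.
  have E1 : c = a1.
    apply: cu => -[|m]; first by rewrite big_ord0 !subr0.
    rewrite big_ord_recl big1 ?addr0 => [|i _]; last first.
      by have -> : a1 (lift ord0 i) = 0 by []; rewrite !rmap0 mul0r.
    have -> : a1 (@ord0 m) = a by [].
    rewrite -[zpow _ _ _]/(rres Z (D2E E W d) ^+ k).
    by rewrite /P rmapM rmapX -rmap_res// subrr; exact: Efil_0.
  have E2 : c = a2.
    apply: cu => -[|m]; first by rewrite big_ord0 !subr0.
    have a20 : a2 (@ord0 m) = 0 by [].
    rewrite big_ord_recl a20 !rmap0 mul0r add0r.
    have sh (i : nat) : k%:Z - i.+1%:Z = k%:Z - 1 - i%:Z.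
      by rewrite intS opprD addrA.
    rewrite sh; under eq_bigr => i _.
      rewrite (_ : a2 (lift ord0 i) = b i)// (_ : k%:Z - (lift ord0 i)%:Z = k%:Z - 1 - i%:Z).
        over.
      exact: sh.
    exact: bE.
  by have := congr1 (fun f => f 0%N) (etrans (esym E1) E2).
have neg Z (ZW : Z `<=o` W) (k : nat) (P : D Z) : frame_poly (rres Z d) k P ->
    Efil (- 1) (D2E E Z P) -> P = 0.
  elim: k P => [|k IH] P //; move=> [a [Q [FQ EP]]] FP.
  suff a0 : a = 0.
    move: EP; rewrite a0 rmap0 mul0r add0r => PQ; rewrite PQ.
    by apply: IH => //; rewrite -PQ.
  apply: (lead Z ZW k).
  have -> : O2D X Z a * rres Z d ^+ k = P - Q by rewrite EP addrK.
  rewrite rmapB; apply: EfilB.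
    by apply: Efil_le FP; rewrite lerBrDr addNr.
  case: k FQ {IH EP} => [->|k FQ]; first by rewrite rmap0; exact: Efil_0.
  apply: (@Efil_le k); first by rewrite intS addrC addKr.
  by apply: Efil_D2E; apply: frame_poly_Dfil FQ; exact: frame_res.
split=> // Z ZW n P FP.
apply: (sh_sep (rsheafP D)) => p' Zp'.
have /asboolP/(_ p' Zp') [Y [Yp YZ [k gP]]] := dvalP P.
exists Y; split=> //; rewrite (rres0 D YZ).
have YW := subset_trans YZ ZW.
have [Q QP FQ] := dgen_frame_poly (frame_res YW fd) gP.
have <- : Q = rres Y P by exact: val_inj.
apply: neg FQ _; first exact: YW.
have -> : Q = rres Y P by exact: val_inj.
have sdn : D2E E Z (rres Z d ^+ n) * rres Z d' ^+ n = 1.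
  by rewrite rmapX exp_inv// rmap_res// -rresM// dd' rres1.
have -> : D2E E Y (rres Y P) = rres Y (D2E E Z (P * rres Z d ^+ n) * rres Z d' ^+ n).
  by rewrite rmapM -mulrA sdn mulr1 rmap_res.
apply: (Efil_res (@open_subT _ _ _ Z)) => //.
rewrite -[- 1](addrK n%:Z) [- 1 + _]addrC; apply: Efil_mul; first exact: Efil_D2E.
by apply: Efil_expN1; apply: (Efil_res (@open_subT _ _ _ W)).
Qed.

End Microdifferential.

End Operators.

Section Twisted.
Variables (R : realType) (X : dcurve R) (E : microdiff X).
Local Notation open := (open X).
Local Notation O := (Osh X).
Local Notation D := (Dsh X).
Implicit Types U W Z : open.
Variables (V : rmod O) (VD : tensor (O2D X) V) (VE : tensor (O2E E) V).

(** * The filtrations of V ⊗ D and V ⊗ E *)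

Lemma VDfil_gen k W (v : V W) (d : D W) : Dfil k d -> VDfil k (tmap VD v *a d).
Proof. by move=> Fd; apply: span_gen; exists v, d. Qed.

Lemma VEfil_gen k W (v : V W) (e : Esh E W) : Efil k e -> VEfil k (tmap VE v *a e).
Proof. by move=> Fe; apply: span_gen; exists v, e. Qed.

Lemma tmap_res (A B : rsheaf X) (f : rmap A B) (N : rmod A) (T : tensor f N) W Z
    (m : N W) : Z `<=o` W -> tmap T (mres Z m) = mres Z (tmap T m).
Proof. by move=> ZW; rewrite (slin_res (tmapP T) (@open_subT _ _ _ W) ZW). Qed.

Lemma tmapA (A B : rsheaf X) (f : rmap A B) (N : rmod A) (T : tensor f N) W
    (m : N W) a : tmap T (m *a a) = tmap T m *a f W a.
Proof. by rewrite (slinA (tmapP T) (@open_subT _ _ _ W)). Qed.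

Lemma tmapN (A B : rsheaf X) (f : rmap A B) (N : rmod A) (T : tensor f N) W
    (m : N W) : tmap T (- m) = - tmap T m.
Proof. by rewrite (slinN (tmapP T) (@open_subT _ _ _ W)). Qed.

Section Generators.
Variable k : int.

Let GD W (x : VD W) := exists v d, Dfil k d /\ x = tmap VD v *a d.
Let GE W (x : VE W) := exists v e, @Efil _ _ E k W e /\ x = tmap VE v *a e.

Let GD_res : res_stable (oT X) (@mres _ _ _ _ VD) GD.
Proof.
move=> W Z x WT ZW [v [d [Fd ->]]]; exists (mres Z v), (rres Z d).
by split; [exact: Dfil_res WT ZW Fd|rewrite tmap_res// mact_res].
Qed.

Let GE_res : res_stable (oT X) (@mres _ _ _ _ VE) GE.
Proof.
move=> W Z x WT ZW [v [d [Fd ->]]]; exists (mres Z v), (rres Z d).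
by split; [exact: Efil_res WT ZW Fd|rewrite tmap_res// mact_res].
Qed.

Lemma VDfil_additive : local_additive (oT X) (@mres _ _ _ _ VD) (@VDfil _ _ _ VD k).
Proof. exact: span_additive GD_res. Qed.

Lemma VEfil_additive : local_additive (oT X) (@mres _ _ _ _ VE) (@VEfil _ _ _ _ VE k).
Proof. exact: span_additive GE_res. Qed.

Lemma VDfil_res : res_stable (oT X) (@mres _ _ _ _ VD) (@VDfil _ _ _ VD k).
Proof. exact: span_res GD_res. Qed.

Lemma VEfil_res : res_stable (oT X) (@mres _ _ _ _ VE) (@VEfil _ _ _ _ VE k).
Proof. exact: span_res GE_res. Qed.

Lemma VEfil0 W : VEfil k (0 : VE W).
Proof. by have [] := VEfil_additive (@open_subT _ _ _ W). Qed.

Lemma VEfilD W (x y : VE W) : VEfil k x -> VEfil k y -> VEfil k (x + y).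
Proof. by have [_ + _] := VEfil_additive (@open_subT _ _ _ W); apply. Qed.

Lemma VEfilN W (x : VE W) : VEfil k x -> VEfil k (- x).
Proof.
apply: (span_opp GE_res); last exact: open_subT.
move=> {}W {}x _ [v [d [Fd ->]]]; exists (- v), d; split=> //.
by rewrite tmapN mactNl.
Qed.

Lemma VEfilB W (x y : VE W) : VEfil k x -> VEfil k y -> VEfil k (x - y).
Proof. by move=> Fx Fy; apply: VEfilD => //; exact: VEfilN. Qed.

Lemma VEfil_local W (x : VE W) :
  (forall p, W p -> exists Z, [/\ Z p, Z `<=o` W & VEfil k (mres Z x)]) ->
  VEfil k x.
Proof. by have [_ _ +] := VEfil_additive (@open_subT _ _ _ W); apply. Qed.

Lemma VDfil_local W (x : VD W) :
  (forall p, W p -> exists Z, [/\ Z p, Z `<=o` W & VDfil k (mres Z x)]) ->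
  VDfil k x.
Proof. by have [_ _ +] := VDfil_additive (@open_subT _ _ _ W); apply. Qed.

End Generators.

Lemma VEfil_mul k l W (x : VE W) (e : Esh E W) :
  VEfil k x -> Efil l e -> VEfil (k + l) (x *a e).
Proof.
move=> Fx Fe; have WT := @open_subT _ _ _ W; move: W x WT Fx e Fe.
pose P W (x : VE W) := forall e : Esh E W, Efil l e -> VEfil (k + l) (x *a e).
apply: (span_min (P := P)) => [W WT|W _ WT [v [d [Fd ->]]] e Fe]; last first.
  by rewrite -mactM; apply: VEfil_gen; exact: Efil_mul.
split=> [e _|x y Px Py e Fe|x Px e Fe].
- by rewrite mact0l; exact: VEfil0.
- by rewrite mactDl; apply: VEfilD; [apply: Px|apply: Py].
apply: VEfil_local => p Wp; have [Z [Zp ZW PZ]] := Px p Wp.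
exists Z; split=> //; rewrite mact_res//; apply: PZ.
exact: Efil_res WT ZW Fe.
Qed.

Lemma VD2VE_slin : is_slin (D2E E) (oT X) (@VD2VE _ _ _ _ VD VE).
Proof. by have [] := tliftP VD (N := rrestr (D2E E) VE) (tmapP VE). Qed.

Lemma VD2VE_tmap W (v : V W) : VD2VE VE (tmap VD v) = tmap VE v.
Proof.
have [_] := tliftP VD (N := rrestr (D2E E) VE) (tmapP VE).
by apply; exact: open_subT.
Qed.

Lemma VD2VE_act W (x : VD W) d : VD2VE VE (x *a d) = VD2VE VE x *a D2E E W d.
Proof. by rewrite (slinA VD2VE_slin (@open_subT _ _ _ W)). Qed.

Lemma VD2VE_res W Z (x : VD W) : Z `<=o` W ->
  VD2VE VE (mres Z x) = mres Z (VD2VE VE x).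
Proof. by move=> ZW; rewrite (slin_res VD2VE_slin (@open_subT _ _ _ W)). Qed.

Lemma VD2VE_fil k W (x : VD W) : VDfil k x -> VEfil k (VD2VE VE x).
Proof.
have WT := @open_subT _ _ _ W; move: W x WT.
apply: (span_min (slin_additive VD2VE_slin (VEfil_additive k))).
move=> W _ WT [v [d [Fd ->]]].
by rewrite VD2VE_act VD2VE_tmap; apply: VEfil_gen; exact: Efil_D2E.
Qed.

(** * Rigidity of filtered automorphisms of V ⊗ D *)

(** Where V is free with basis [e_i], the [e_i ⊗ 1] are a basis of V ⊗ D; the
    coordinates of [v ⊗ d] are those of [v] multiplied by [d], whence the last
    assertion. *)
Lemma VD_coordinates r p : is_vector_bundle r V -> dc_pts X p ->
  exists W (c : forall Z, VD Z -> rfree D r Z),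
    [/\ W p, is_hom W c,
        forall Z, Z `<=o` W -> forall x : VD Z, c Z x = 0 -> x = 0 &
        forall k Z, Z `<=o` W -> forall x : VD Z, VDfil k x ->
          forall i, Dfil k (c Z x i)].
Proof.
move=> hV Xp; have [W [h [Wp [hh [g hg [gh hgE]]]]]] := hV p Xp.
pose u Z (v : V Z) : rfree D r Z := [ffun i => O2D X Z (g Z v i)].
have hu : is_slin (O2D X) W u.
  move=> Z ZW; split=> [v v'|v a|Y YZ v]; apply/ffunP => i; rewrite !ffunE.
  - by rewrite (slinD hg ZW) ffunE rmapD.
  - by rewrite (slinA hg ZW) ffunE rmapM.
  - by rewrite (slin_res hg ZW YZ) ffunE rmap_res.
have [hc cE] := tliftP VD hu; set c := tlift _ _ in hc cE.
exists W, c; split=> //.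
  pose b Z (i : 'I_r) : rfree O r Z := [ffun j => (i == j)%:R].
  pose s Z (y : rfree D r Z) : VD Z := \sum_i tmap VD (h Z (b Z i)) *a y i.
  have hs : is_hom W s.
    move=> Z ZW; split=> [x y|x a|Y YZ x].
    - rewrite /s -big_split; apply: eq_bigr => i _.
      by rewrite ffunE mactDr.
    - rewrite /s (big_morph (fun m => m *a a) (id1 := 0) (op1 := +%R)).
      + by apply: eq_bigr => i _; rewrite ffunE mactM.
      + by move=> m m'; rewrite mactDl.
      + exact: mact0l.
    - rewrite /s (big_morph (@mres _ _ _ _ VD Z Y) (id1 := 0) (op1 := +%R)).
      + apply: eq_bigr => i _; rewrite ffunE mact_res// -tmap_res//.
        rewrite -(slin_res hh ZW YZ); congr (tmap _ (h _ _) *a _).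
        apply/ffunP => j; rewrite !ffunE.
        by case: eqP; rewrite ?rres1// rres0.
      + exact: mresD.
      + exact: mres0.
  move=> Z ZW x cx0.
  have := tensor_ext (hom_comp hc hs) (@id_hom _ _ _ _ W VD) _ ZW x.
  rewrite cx0 (slin0 hs ZW) => -> // {Z ZW x cx0} Z ZW v.
  rewrite cE// /s; under eq_bigr => i _ do rewrite ffunE -tmapA -(slinA hh ZW).
  have tD := slinD (tmapP VD) (@open_subT _ _ _ Z).
  have t0 := slin0 (tmapP VD) (@open_subT _ _ _ Z).
  rewrite -(big_morph _ tD t0) -(big_morph _ (slinD hh ZW) (slin0 hh ZW)).
  rewrite -[in RHS](hgE Z ZW v); congr (tmap _ (h _ _)).
  apply/ffunP => j; rewrite sum_ffunE (bigD1 j)//= big1 => [|i ij].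
    by rewrite addr0 !ffunE eqxx mul1r.
  by rewrite !ffunE (negbTE ij) mul0r.
move=> k Z ZW x Fx i; move: Z x ZW Fx.
apply: span_min.
  move=> Z ZW; have [D0 DD Dl] := @Dfil_additive _ X k Z (@open_subT _ _ _ Z).
  split=> [|x y Fx Fy|x Fx].
  - by rewrite (slin0 hc ZW) ffunE.
  - by rewrite (slinD hc ZW) ffunE; apply: DD.
  apply: Dl => q Zq; have [Y [Yq YZ FY]] := Fx q Zq; exists Y; split=> //.
  by have := FY; rewrite (slin_res hc ZW YZ) ffunE.
move=> Z _ ZW [v [d [Fd ->]]]; rewrite (slinA hc ZW) cE// !ffunE.
exact: Dfil_fun_mul.
Qed.

(** For [n] large, [h (v ⊗ 1) d^n = h (v ⊗ d^n)] has order less than [n], so that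
    [h (v ⊗ 1)] has negative order in each coordinate. *)
Lemma rigidity r U (h : forall W, VD W -> VD W) (K : int) :
  is_vector_bundle r V -> is_hom U h ->
  (forall k W x, K <= k -> W `<=o` U -> VDfil k x -> VDfil (k - 1) (h W x)) ->
  eq_over U h (fun=> fun=> 0).
Proof.
move=> hV hh hdeg; apply: tensor_ext => //; first exact: zero_hom.
move=> W WU v; apply: (sh_sep (rmodP VD)) => p Wp.
have Xp : dc_pts X p by apply: open_subT Wp.
have [W1 [c [W1p hc cinj cfil]]] := VD_coordinates hV Xp.
have [W2 [d [d' [W2p sd]]]] := chart_exists E Xp.
pose Z := oI W (oI W1 W2).
have ZW : Z `<=o` W by exact: oIl.
have ZW1 : Z `<=o` W1 by move=> q [_ []].
have ZW2 : Z `<=o` W2 by move=> q [_ []].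
have ZU := subset_trans ZW WU.
exists Z; split=> //; rewrite mres0// -(slin_res hh WU ZW) -tmap_res//.
apply: (cinj Z ZW1); apply/ffunP => i; rewrite [RHS]ffunE.
pose n := `|K|%N.
apply: (chart_sep sd ZW2 (n := n)).
have Fdn : Dfil n (rres Z d ^+ n) by apply: Dfil_exp; apply: chart_d (chart_res ZW2 sd).
have := hdeg n Z _ (lez_abs K) ZU (VDfil_gen (mres Z v) Fdn).
rewrite (slinA hh ZU) => /(cfil _ _ ZW1)/(_ i).
by rewrite (slinA hc ZW1) ffunE.
Qed.

End Twisted.

(** * Framed bundles *)

Section FramedBundles.
Variables (R : realType) (X : dcurve R) (E : microdiff X).
Local Notation open := (open X).
Local Notation O := (Osh X).
Local Notation D := (Dsh X).
Implicit Types U T W Z : open.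
Variables (r : nat) (V : rmod O) (VD : tensor (O2D X) V) (VE : tensor (O2E E) V).

Section Framing.
Variables (M : framed VD) (ME : tensor (D2E E) M) (T : open).
Hypothesis hM : is_framed r T ME.

Lemma ffil_additive k : local_additive T (@mres _ _ _ _ M) (@ffil _ _ _ _ M k).
Proof. by apply: subsheaf_additive; have [_ [[]]] := hM. Qed.

Lemma ffil_res k : res_stable T (@mres _ _ _ _ M) (@ffil _ _ _ _ M k).
Proof.
by move=> W Z m WT ZW; have [_ [[+ _ _] _]] := hM => /(_ k W WT) [_ _ + _]; apply.
Qed.

Lemma ffil0 k W : W `<=o` T -> ffil k (0 : M W).
Proof. by move=> WT; have [] := ffil_additive k WT. Qed.

Lemma ffil_act k l W (m : M W) (d : D W) : W `<=o` T ->
  ffil k m -> Dfil l d -> ffil (k + l) (m *a d).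
Proof. by have [_ [_ [+ _]]] := hM; apply. Qed.

Lemma fgr_quotient k : fk0 M <= k ->
  quotient_iso T (@mres _ _ _ _ M) (@mres _ _ _ _ VD)
    (@ffil _ _ _ _ M k) (@ffil _ _ _ _ M (k - 1))
    (@VDfil _ _ _ VD k) (@VDfil _ _ _ VD (k - 1)) (@fgr _ _ _ _ M k).
Proof. by have [_ [_ [_ [+ _]]]] := hM; apply. Qed.

Variables (k : int) (W : open).
Hypotheses (hk : fk0 M <= k) (WT : W `<=o` T).

Lemma fgr_ffil (m : M W) z : fgr k m z -> ffil k m.
Proof. by have [+ _] := fgr_quotient hk WT; move=> /[apply] -[]. Qed.

Lemma fgr_res Z (m : M W) z : Z `<=o` W -> fgr k m z -> fgr k (mres Z m) (mres Z z).
Proof. by have [_ [[_ + _ _ _] _]] := fgr_quotient hk WT; apply. Qed.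

Lemma fgr_local (m : M W) z : (forall p, W p -> exists Z,
    [/\ Z p, Z `<=o` W & fgr k (mres Z m) (mres Z z)]) -> fgr k m z.
Proof. by have [_ [[_ _ + _ _] _]] := fgr_quotient hk WT; apply. Qed.

Lemma fgr_diff (m : M W) z z' : fgr k m z -> fgr k m z' -> VDfil (k - 1) (z - z').
Proof.
move=> mz mz'; have [_ [[gB _ _ _ g0] _]] := fgr_quotient hk WT.
have := gB _ _ _ _ mz mz'; rewrite subrr => /g0 [+ _]; apply.
exact: ffil0.
Qed.

Lemma fgr_shift (m : M W) z z' : fgr k m z -> VDfil (k - 1) (z - z') -> fgr k m z'.
Proof.
move=> mz zz'; have [_ [[gB _ _ gl _] _]] := fgr_quotient hk WT.
have := gB _ _ _ _ mz (gl 0 (z - z') (ffil0 _ WT) zz').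
by rewrite subr0 opprB addrC subrK.
Qed.

End Framing.

(** * The canonical trivialization over the trivial locus *)

Lemma framed_triv_sub (M : framed VD) U U' (phi : forall W, M W -> VD W) :
  U' `<=o` U -> framed_triv U phi -> framed_triv U' phi.
Proof.
move=> U'U [iphi tphi]; split; first exact: is_iso_sub iphi.
by move=> k hk W WU' m; apply: tphi => //; apply: subset_trans U'U.
Qed.

Section Uniqueness.
Hypothesis hV : is_vector_bundle r V.

(** Rigidity, transported to a bundle that is isomorphic to V ⊗ D. *)
Lemma triv_rigid U (M : rmod D) (phi g : forall W, M W -> VD W) (K : int) :
  is_iso U phi -> is_hom U g ->
  (forall k W m, K <= k -> W `<=o` U ->
     VDfil k (phi W m) -> VDfil (k - 1) (phi W m - g W m)) ->
  eq_over U g phi.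
Proof.
move=> [hphi [s hs [sphi phis]]] hg hdeg W WU m.
have hd := hom_sub (@id_hom _ _ _ _ U VD) (hom_comp hs hg).
have := rigidity E (K := K) hV hd _ WU (phi W m).
rewrite sphi// => /(_ _)/subr0_eq -> // k Z x Kk ZU Fx.
have := hdeg k Z (s Z x) Kk ZU; rewrite phis//; exact.
Qed.

Lemma triv_unique (M : framed VD) (ME : tensor (D2E E) M) T U
    (phi phi' : forall W, M W -> VD W) :
  is_framed r T ME -> U `<=o` T ->
  framed_triv U phi -> framed_triv U phi' -> eq_over U phi' phi.
Proof.
move=> hM UT [iphi tphi] [[hphi' _] tphi'].
apply: (triv_rigid (K := fk0 M)) => // k W m hk WU Fm.
have [/proj2/(_ Fm) km /(_ _) kg] := tphi k hk W WU m.
have [_ kg'] := tphi' k hk W WU m.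
by apply: (fgr_diff hM hk (subset_trans WU UT) (m := m)); [apply: kg|apply: kg'].
Qed.

(** Uniqueness on overlaps lets the local trivializations be glued. *)
Lemma triv_exists (M : framed VD) (ME : tensor (D2E E) M) :
  is_framed r (oT X) ME ->
  exists phi : forall W, M W -> VD W, framed_triv (triv_locus M) phi.
Proof.
move=> hM; set U := triv_locus M.
have [W h [[hh _] _]//|p [W [h [Wp th]]]|W W' Z h h' th th' ZW ZW'|phi hphi phiE] :=
    @hom_glue _ _ _ _ U M VD (fun W h => framed_triv W h).
- by exists W, h.
- apply: (triv_unique hM (@open_subT _ _ _ Z)).
    exact: framed_triv_sub th'.
  exact: framed_triv_sub th.
have loc p : U p -> exists W h, [/\ W p, W `<=o` U & framed_triv W h /\ eq_over W phi h].
  move=> [W [h [Wp th]]]; have WU : W `<=o` U by move=> q Wq; exists W, h.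
  by exists W, h; split=> //; split=> //; apply: phiE.
exists phi; split.
  apply: iso_local => // p Up; have [W [h [Wp WU [[[hh [g hg [gh hgE]]] _] E1]]]] := loc p Up.
  exists W; split=> //; split; first exact: slin_sub hphi.
  by exists g => //; split=> Z ZW x; rewrite E1 // ?gh ?hgE.
move=> k hk W WU m.
have WT := @open_subT _ _ _ W.
have locW p : W p -> exists Z h, [/\ Z p, Z `<=o` W & framed_triv Z h /\ eq_over Z phi h].
  move=> Wp; have [Z [h [Zp ZU [th E1]]]] := loc p (WU p Wp).
  exists (oI W Z), h; split=> //; first exact: oIl.
  split; first exact: (framed_triv_sub (@oIr _ _ _ W Z)).
  by move=> Y YI; apply: E1; apply: subset_trans (@oIr _ _ _ W Z).
split; first split.
- move=> Fm; apply: VDfil_local => p Wp.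
  have [Z [h [Zp ZW [[_ th] E1]]]] := locW p Wp.
  exists Z; split=> //; rewrite -(slin_res hphi WU ZW) E1//.
  by apply: (proj1 (th k hk Z _ _)).1 => //; apply: (ffil_res hM WT).
- move=> Fm; have [_ _ ml] := ffil_additive hM k WT; apply: ml => p Wp.
  have [Z [h [Zp ZW [[_ th] E1]]]] := locW p Wp.
  exists Z; split=> //; apply: (proj1 (th k hk Z _ _)).2 => //.
  by rewrite -E1// (slin_res hphi WU ZW); apply: VDfil_res Fm.
move=> Fm; apply: (fgr_local hM hk WT) => p Wp.
have [Z [h [Zp ZW [[_ th] E1]]]] := locW p Wp.
exists Z; split=> //; rewrite -(slin_res hphi WU ZW) E1//.
by apply: (proj2 (th k hk Z _ _)) => //; apply: (ffil_res hM WT).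
Qed.

(** A framed isomorphism followed by a trivialization is a trivialization, up to
    a change of the degree from which the framings are compared; the rigidity
    argument is insensitive to that degree. *)
Lemma framed_iso_unique (M N : framed VD) (NE : tensor (D2E E) N) T U
    (phi : forall W, M W -> VD W) (psi : forall W, N W -> VD W)
    (f : forall W, M W -> N W) :
  is_framed r T NE -> U `<=o` T ->
  framed_triv U phi -> framed_triv U psi -> framed_iso U f ->
  eq_over U (fun W m => psi W (f W m)) phi.
Proof.
move=> hN UT [iphi tphi] [[hpsi _] tpsi] [[hf _] tf].
apply: (triv_rigid (K := Num.max (fk0 M) (fk0 N))) => //; first exact: hom_comp hpsi.
move=> k W m; rewrite ge_max => /andP[kM kN] WU Fm.
have [/proj2/(_ Fm) km /(_ km) gm] := tphi k kM W WU m.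
have [/proj1/(_ km) kfm fgm] := tf k kM kN W WU m.
apply: (fgr_diff hN kN (subset_trans WU UT) (m := f W m)).
  exact: (proj1 (fgm _)).
by have [_ +] := tpsi k kN W WU (f W m); apply.
Qed.

End Uniqueness.

(** * Micro-opers read through a trivialization *)

Section Trivialized.
Variables (M : framed VD) (ME : tensor (D2E E) M) (T U : open).
Hypotheses (hM : is_framed r T ME) (UT : U `<=o` T).
Variables (phi : forall W, M W -> VD W) (tphi : framed_triv U phi).
Arguments phi : clear implicits.

Local Notation tE := (triv_E VE U ME phi).

Let hphi : is_hom U phi. Proof. by case: tphi => -[]. Qed.

Lemma triv_E_slin : is_slin (D2E E) U (fun W m => VD2VE VE (phi W m)).
Proof. exact: (slin_comp hphi (slin_sub (@open_subT _ _ _ U) (@VD2VE_slin _ _ _ _ VD VE))). Qed.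

Lemma triv_E_hom : is_hom U tE.
Proof. by have [] := tliftP ME triv_E_slin. Qed.

Lemma triv_E_tmap W (m : M W) : W `<=o` U -> tE W (tmap ME m) = VD2VE VE (phi W m).
Proof. by move=> WU; have [_] := tliftP ME triv_E_slin; apply. Qed.

(** The inverse is induced by v |-> phi^-1(v ⊗ 1), through V ⊗ E. *)
Lemma triv_E_iso : is_iso U tE.
Proof.
have [[_ [s hs [sphi phis]]] _] := tphi.
have VDU := slin_sub (@open_subT _ _ _ U) (tmapP VD).
have MEU := slin_sub (@open_subT _ _ _ U) (tmapP ME).
pose g W (v : V W) : ME W := tmap ME (s W (tmap VD v)).
have hg : is_slin (O2E E) U g := slin_comp (slin_comp VDU hs) MEU.
have [ht tE'] := tliftP VE hg; set t := tlift _ _ in ht tE'.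
split; first exact: triv_E_hom.
exists t => //; split.
  apply: tensor_ext; [exact: hom_comp triv_E_hom ht|exact: id_hom|].
  have hl := slin_comp (slin_sub (@open_subT _ _ _ U) (@VD2VE_slin _ _ _ _ VD VE)) ht.
  have key : eq_over U (fun W z => t W (VD2VE VE z)) (fun W z => tmap ME (s W z)).
    apply: (tensor_ext (N := rrestr (D2E E) ME)) hl (slin_comp hs MEU) _.
    by move=> W WU v; rewrite VD2VE_tmap tE'.
  by move=> W WU m; rewrite triv_E_tmap// key// sphi.
apply: tensor_ext; [exact: hom_comp ht triv_E_hom|exact: id_hom|].
by move=> W WU v; rewrite tE'// triv_E_tmap// phis// VD2VE_tmap.
Qed.

(** Below the degree [fk0 M] the trivialization is not known to respect the
    filtrations in D; in E it does, as one sees by multiplying by [d^n] and then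
    by its inverse. *)
Lemma phi_fil k W (m : M W) : W `<=o` U -> ffil k m -> VEfil k (VD2VE VE (phi W m)).
Proof.
move=> WU Fm; apply: VEfil_local => p Wp.
have [Y [d [d' [Yp sd]]]] := chart_exists E (@open_subT _ _ _ W p Wp).
pose Z := oI W Y; have ZW : Z `<=o` W := @oIl _ _ _ W Y.
have sdZ := chart_res (@oIr _ _ _ W Y) sd; rewrite -/Z in sdZ.
exists Z; split=> //; rewrite -VD2VE_res// -(slin_res hphi WU)//.
have ZU := subset_trans ZW WU; have WT := subset_trans WU UT.
move: (mres Z m) (ffil_res hM WT ZW Fm) => {Fm}m Fm.
move: (rres Z d) (rres Z d') sdZ => {sd}d {}d' sd.
pose n := `|fk0 M - k|%N.
have kn : fk0 M <= k + n by rewrite -lerBlDl lez_abs.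
have Fdn : Dfil n (d ^+ n) by apply: Dfil_exp; exact: chart_d sd.
have ZT := subset_trans ZU UT.
have := proj1 (proj1 (tphi.2 _ kn Z ZU (m *a d ^+ n))) (ffil_act hM ZT Fm Fdn).
rewrite (slinA hphi ZU) => /(VD2VE_fil VE); rewrite VD2VE_act => F1.
have := VEfil_mul F1 (Efil_expN1 n (chart_d' sd)).
by rewrite -mactM chart_exp// mact1 addrK.
Qed.

Lemma MEfil_triv k W (x : ME W) : W `<=o` U -> MEfil k x -> VEfil k (tE W x).
Proof.
move: W x; apply: span_min => [|W _ WU [j [m [e [Fm Fe ->]]]]].
  apply: slin_additive triv_E_hom _.
  exact: local_additive_sub (@open_subT _ _ _ U) (VEfil_additive VE k).
rewrite (slinA triv_E_hom WU) triv_E_tmap//.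
by have := VEfil_mul (phi_fil WU Fm) Fe; rewrite addrK.
Qed.

Let MEgen k W (x : ME W) := exists (j : nat) m e,
  [/\ ffil (k + j%:Z) m, Efil (- j%:Z) e & x = tmap ME m *a e].

Let MEgen_res k : res_stable U (@mres _ _ _ _ ME) (@MEgen k).
Proof.
move=> W Z x WU ZW [j [m [e [Fm Fe ->]]]].
exists j, (mres Z m), (rres Z e); split.
- by apply: (ffil_res hM) ZW Fm; apply: subset_trans UT.
- exact: Efil_res (@open_subT _ _ _ W) ZW Fe.
- by rewrite tmap_res// mact_res.
Qed.

Lemma MEfil_additive k : local_additive U (@mres _ _ _ _ ME) (@MEfil _ _ _ _ _ _ ME k).
Proof. exact: span_additive (@MEgen_res k). Qed.

Lemma MEfil_res k : res_stable U (@mres _ _ _ _ ME) (@MEfil _ _ _ _ _ _ ME k).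
Proof. exact: span_res (@MEgen_res k). Qed.

Lemma MEfil0 k W : W `<=o` U -> MEfil k (0 : ME W).
Proof. by move=> WU; have [] := MEfil_additive k WU. Qed.

Lemma MEgrD k W (x x' : ME W) (y y' : VE W) : W `<=o` U ->
  MEgr k x y -> MEgr k x' y' -> MEgr k (x + x') (y + y').
Proof.
apply: span2_add => {}W Z {x'} {}x {y'} {}y WU ZW.
have WT := subset_trans WU UT.
case=> [[l [m [z [e [hl mz Fe [-> ->]]]]]]|[Fx Fy]].
  left; exists l, (mres Z m), (mres Z z), (rres Z e); split=> //.
  - exact: (fgr_res hM hl WT ZW mz).
  - exact: Efil_res (@open_subT _ _ _ W) ZW Fe.
  - by rewrite tmap_res// VD2VE_res// !mact_res.
by right; split; [exact: MEfil_res Fx|exact: VEfil_res (@open_subT _ _ _ W) ZW Fy].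
Qed.

(** Every section [v ⊗ e] equals [v ⊗ d^n ⊗ d^-n e], where [n] is so large that
    the framing of M sees [v ⊗ d^n]; hence the filtration and the symbol of
    V ⊗ E are those which the framing induces. *)
Lemma triv_E_onto k W (x : ME W) : W `<=o` U -> VEfil k (tE W x) ->
  MEfil k x /\ MEgr k x (tE W x).
Proof.
move=> WU Fx.
have [_ [t ht [tEK KtE]]] := triv_E_iso.
have [[_ [s hs [sphi phis]]] tphi'] := tphi.
pose P W (y : VE W) := MEfil k (t W y) /\ MEgr k (t W y) y.
suff: P W (tE W x) by rewrite /P tEK.
move: W {x Fx}(tE W x) WU Fx.
apply: span_min => [W WU|W _ WU [v [e [Fe ->]]]].
  have [F0 FD Fl] := MEfil_additive k WU.
  split=> [|y z [Fy Gy] [Fz Gz]|y Py].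
  - by rewrite /P (slin0 ht WU); split=> //; exact: span2_0.
  - by rewrite /P (slinD ht WU); split; [exact: FD|exact: MEgrD].
  split.
    apply: Fl => p Wp; have [Z [Zp ZW [FZ _]]] := Py p Wp.
    by exists Z; split=> //; rewrite -(slin_res ht WU).
  apply: span2_local => p Wp; have [Z [Zp ZW [_ GZ]]] := Py p Wp.
  by exists Z; split=> //; rewrite -(slin_res ht WU).
suff loc p : W p -> exists Z, [/\ Z p, Z `<=o` W & P Z (mres Z (tmap VE v *a e))].
  split.
    have [_ _ Fl] := MEfil_additive k WU.
    apply: Fl => p Wp; have [Z [Zp ZW [FZ _]]] := loc p Wp.
    by exists Z; split=> //; rewrite -(slin_res ht WU).
  apply: span2_local => p Wp; have [Z [Zp ZW [_ GZ]]] := loc p Wp.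
  by exists Z; split=> //; rewrite -(slin_res ht WU).
move=> Wp; have [Y [d [d' [Yp sd]]]] := chart_exists E (@open_subT _ _ _ W p Wp).
pose Z := oI W Y; have ZW : Z `<=o` W := @oIl _ _ _ W Y.
have sdZ := chart_res (@oIr _ _ _ W Y) sd; rewrite -/Z in sdZ.
exists Z; split=> //; have ZU := subset_trans ZW WU.
rewrite mact_res// -tmap_res//.
move: (mres Z v) (rres Z e) (Efil_res (@open_subT _ _ _ W) ZW Fe) => {Fe}v {}e Fe.
move: (rres Z d) (rres Z d') sdZ => {sd}d {}d' sd.
pose n := `|Num.max (fk0 M) k|%N.
have /andP[nM nk] : (fk0 M <= n) && (k <= n) by rewrite -ge_max lez_abs.
have Fdn : Dfil n (d ^+ n) by apply: Dfil_exp; exact: chart_d sd.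
pose z := tmap VD v *a d ^+ n; pose m := s Z z.
have phim : phi Z m = z by rewrite phis.
have [fm gm] := tphi' n nM Z ZU m.
have Fm : ffil n m by apply/fm; rewrite phim; exact: VDfil_gen.
move/(_ Fm): gm => {fm}; rewrite phim => gm.
have Fe' : Efil (k - n%:Z) (d' ^+ n * e).
  by rewrite addrC; apply: Efil_mul => //; apply: Efil_expN1; exact: chart_d' sd.
have zE : VD2VE VE z *a (d' ^+ n * e) = tmap VE v *a e.
  by rewrite VD2VE_act VD2VE_tmap -mactM mulrA chart_exp// mul1r.
have tz : t Z (tmap VE v *a e) = tmap ME m *a (d' ^+ n * e).
  rewrite -[RHS](tEK Z ZU); congr (t Z _).
  by rewrite (slinA triv_E_hom ZU) triv_E_tmap// phim zE.
rewrite /P tz; split.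
  apply: span_gen; exists `|n%:Z - k|%N, m, (d' ^+ n * e).
  have -> : `|n%:Z - k|%N%:Z = n%:Z - k by rewrite gez0_abs// subr_ge0.
  by rewrite opprB addrC subrK.
by apply: span2_gen; left; exists n%:Z, m, z, (d' ^+ n * e); rewrite zE.
Qed.

(** The graph of [gr_k M_E -> V ⊗ gr_k E] is that of [tE] modulo lower order: for
    the generators this is [triv_E_onto] in one direction, and in the other the
    fact that [phi m] represents the symbol of [m]. *)
Lemma MEgr_triv k W (x : ME W) (y : VE W) : W `<=o` U -> MEfil k x ->
  MEgr k x y <-> VEfil (k - 1) (y - tE W x).
Proof.
move=> WU Fx; split=> [|Fy]; last first.
  have [_ Gx] := triv_E_onto WU (MEfil_triv WU Fx).
  rewrite -[x]addr0 -[y](subrK (tE W x)) addrC; apply: MEgrD => //.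
  by apply: span2_gen; right; split=> //; exact: MEfil0.
move: W x y WU {Fx}.
apply: span2_min => [W WU|W x y WU].
  split=> [|x y x' y' Fx Fx'|x y Fx].
  - by rewrite (slin0 triv_E_hom WU) subr0; exact: VEfil0.
  - by rewrite (slinD triv_E_hom WU) opprD addrACA; apply: VEfilD.
  - apply: VEfil_local => p Wp; have [Z [Zp ZW FZ]] := Fx p Wp.
    by exists Z; split=> //; rewrite mresB// -(slin_res triv_E_hom WU).
case=> [[l [m [z [e [hl mz Fe [-> ->]]]]]]|[Fx Fy]]; last first.
  by apply: VEfilB => //; exact: MEfil_triv.
have WT := subset_trans WU UT.
have [_ /(_ (fgr_ffil hM hl WT mz)) mphi] := tphi.2 l hl W WU m.
rewrite (slinA triv_E_hom WU) triv_E_tmap// -mactNl -mactDl.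
rewrite -(slinB (@VD2VE_slin _ _ _ _ VD VE) (@open_subT _ _ _ W)).
have := VEfil_mul (VD2VE_fil VE (fgr_diff hM hl WT mz mphi)) Fe.
have -> : k - 1 = l - 1 + (k - l) by rewrite [RHS]addrC addrA subrK.
by [].
Qed.

Section Transport.
Variables (dM : forall W, ME W -> ME W) (L : forall W, VE W -> VE W).
Hypothesis dL : corresponds U phi dM L.

(** The symbol condition for [dM] is applied to the [x] with [tE x = v ⊗ e]. *)
Lemma micro_oper_Lax : is_hom U L -> is_micro_oper VE U dM -> is_Lax U L.
Proof.
have [_ [t ht [tEK KtE]]] := triv_E_iso.
move=> hL [hd dfil dgr]; split=> // k W.
  move=> x WU Fx; rewrite -[x]KtE// -dL//; apply: MEfil_triv => //; apply: dfil => //.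
  by apply: (proj1 (triv_E_onto WU _)); rewrite KtE.
move=> v e WU Fe; pose x := t W (tmap VE v *a e).
have xE : tE W x = tmap VE v *a e by rewrite KtE.
have [Fx Gx] : MEfil k x /\ MEgr k x (tE W x).
  by apply: triv_E_onto => //; rewrite xE; exact: VEfil_gen.
rewrite xE in Gx; have := dgr k W x v e WU Fx Fe Gx.
move/(MEgr_triv _ WU (dfil k W x WU Fx)); rewrite addrK dL// xE => /VEfilN.
by rewrite opprB.
Qed.

(** Here [tE x] is only congruent to [v ⊗ e] modulo order [k - 1]; since [L] has
    degree 1, the error becomes one of order [k]. *)
Lemma Lax_micro_oper : is_hom U dM -> is_Lax U L -> is_micro_oper VE U dM.
Proof.
move=> hd [hL Lfil Lsym].
have dfil k W (x : ME W) : W `<=o` U -> MEfil k x -> MEfil (k + 1) (dM x).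
  move=> WU Fx; apply: (proj1 (triv_E_onto WU _)); rewrite dL//; apply: Lfil => //.
  exact: MEfil_triv.
split=> // k W x v e WU Fx Fe /(MEgr_triv _ WU Fx) Fve.
apply/(MEgr_triv _ WU (dfil k W x WU Fx)); rewrite addrK dL//.
rewrite -opprB; apply: VEfilN.
have -> : L (tE W x) = L (tmap VE v *a e) - L (tmap VE v *a e - tE W x).
  by rewrite -(slinB hL WU) subKr.
rewrite addrAC; apply: VEfilB; first exact: Lsym.
by have := Lfil (k - 1) W _ WU Fve; rewrite subrK.
Qed.

End Transport.

End Trivialized.

Section Isomorphisms.
Variables (M N : framed VD) (ME : tensor (D2E E) M) (NE : tensor (D2E E) N).
Variables (T T' U : open) (hM : is_framed r T ME) (hN : is_framed r T' NE).
Hypotheses (UT : U `<=o` T) (UT' : U `<=o` T').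
Variables (phi : forall W, M W -> VD W) (psi : forall W, N W -> VD W).
Arguments phi : clear implicits.
Arguments psi : clear implicits.
Hypotheses (tphi : framed_triv U phi) (tpsi : framed_triv U psi).
Variables (f : forall W, M W -> N W).
Arguments f : clear implicits.
Hypothesis (hf : is_iso U f).
Hypothesis (fE : eq_over U (fun W m => psi W (f W m)) phi).

(** Modulo lower order the symbol of [m] is represented by [phi m], and that of
    [f m] by [psi (f m)], which is the same section. *)
Lemma framed_iso_triv : framed_iso U f.
Proof.
have [_ tphi'] := tphi; have [_ tpsi'] := tpsi.
split=> // k kM kN W WU m; have WT := subset_trans WU UT; have WT' := subset_trans WU UT'.
have [fm gm] := tphi' k kM W WU m; have [fn gn] := tpsi' k kN W WU (f W m).
have fmn : ffil k m <-> ffil k (f W m).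
  by apply: (iff_trans fm); rewrite -fE//; exact: iff_sym.
split=> // x; split=> [mx|nx].
  have Fm := fgr_ffil hM kM WT mx; have Fn := (proj1 fmn) Fm.
  apply: (fgr_shift hN kN WT' (gn Fn)); rewrite fE//.
  exact: (fgr_diff hM kM WT (gm Fm) mx).
have Fn := fgr_ffil hN kN WT' nx; have Fm := (proj2 fmn) Fn.
apply: (fgr_shift hM kM WT (gm Fm)); rewrite -fE//.
exact: (fgr_diff hN kN WT' (gn Fn) nx).
Qed.

Lemma intertwines_triv (dM : forall W, ME W -> ME W) (dN : forall W, NE W -> NE W)
    (L : forall W, VE W -> VE W) :
  corresponds U phi dM L -> corresponds U psi dN L -> intertwines U f dM dN.
Proof.
rewrite /intertwines => ML NL W WU x.
have hfE : is_slin (D2E E) U (fun W m => tmap NE (f W m)).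
  exact: slin_comp hf.1 (slin_sub (@open_subT _ _ _ U) (tmapP NE)).
have [hF FE] := tliftP ME hfE; move: (tlift _ _) hF FE => F hF FE.
have tF : eq_over U (fun W x => triv_E VE U NE psi W (F W x)) (triv_E VE U ME phi).
  apply: tensor_ext.
  - exact: hom_comp hF (triv_E_hom NE tpsi).
  - exact: triv_E_hom.
  - by move=> Z ZU m; rewrite FE// !triv_E_tmap// fE.
have [_ [t _ [tEK _]]] := triv_E_iso NE tpsi.
by rewrite -[LHS]tEK// -[RHS]tEK// tF// ML// NL// tF.
Qed.

End Isomorphisms.

End FramedBundles.

Theorem corollary3p22 (R : realType) (X : dcurve R) (E : microdiff X)
    (r : nat) (V : rmod (Osh X)) (hV : is_vector_bundle r V)
    (VD : tensor (O2D X) V) (VE : tensor (O2E E) V)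
    (M : framed VD) (ME : tensor (D2E E) M) (hM : is_framed r (oT X) ME)
    (dM : forall W, ME W -> ME W) (hdM : is_micro_oper VE (oT X) dM) :
  let U := triv_locus M in
  exists phi : forall W, M W -> VD W,
    (* the canonical identifications over U *)
    [/\ framed_triv U phi,
        forall phi' : forall W, M W -> VD W,
          framed_triv U phi' -> eq_over U phi' phi &
        is_iso U (triv_E VE U ME phi)] /\
    (* the micro-oper determines a Lax operator *)
    (exists L : forall W, VE W -> VE W,
      [/\ is_Lax U L, corresponds U phi dM L &
          forall L' : forall W, VE W -> VE W,
            is_Lax U L' -> corresponds U phi dM L' -> eq_over U L' L]) /\
    (* every Lax operator arises from exactly one micro-oper structure *)
    (forall L : forall W, VE W -> VE W, is_Lax U L ->
      exists d : forall W, ME W -> ME W,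
        [/\ is_micro_oper VE U d, corresponds U phi d L &
            forall d' : forall W, ME W -> ME W,
              is_micro_oper VE U d' -> corresponds U phi d' L ->
              eq_over U d' d]) /\
    (* micro-opers over U with the same Lax operator are uniquely isomorphic *)
    (forall (N : framed VD) (NE : tensor (D2E E) N)
        (dN : forall W, NE W -> NE W) (psi : forall W, N W -> VD W)
        (L : forall W, VE W -> VE W),
      is_framed r U NE -> is_micro_oper VE U dN -> framed_triv U psi ->
      is_Lax U L -> corresponds U phi dM L -> corresponds U psi dN L ->
      exists f : forall W, M W -> N W,
        [/\ framed_iso U f, intertwines U f dM dN &
            forall f' : forall W, M W -> N W,
              framed_iso U f' -> eq_over U f' f]).
Proof.
move=> U; have UT : U `<=o` oT X := @open_subT _ _ _ U.
have [phi tphi] := triv_exists hV hM; rewrite -/U in tphi.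
have iE := triv_E_iso VE ME tphi.
have [hE [t ht [tEK KtE]]] := iE.
exists phi; split; [split=> // phi' tphi'|split; [|split]].
- exact: (triv_unique hV hM UT tphi tphi').
- have hdU : is_micro_oper VE U dM.
    have [hd dfil dgr] := hdM; split; first exact: slin_sub hd.
      by move=> k W x WU; apply: dfil; exact: open_subT.
    by move=> k W x v e WU; apply: dgr; exact: open_subT.
  pose L W (y : VE W) := triv_E VE U ME phi W (dM W (t W y)).
  have dL : corresponds U phi dM L by move=> W WU x; rewrite /L tEK.
  exists L; split=> //.
    apply: (micro_oper_Lax hM UT tphi dL) => //.
    by have [hd _ _] := hdU; exact: hom_comp (hom_comp ht hd) hE.
  by move=> L' _ dL' W WU y; rewrite -[y]KtE// -dL// -dL'.
- move=> L hL; pose d W (x : ME W) := t W (L W (triv_E VE U ME phi W x)).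
  have dL : corresponds U phi d L by move=> W WU x; rewrite /d KtE.
  exists d; split=> //.
    apply: (Lax_micro_oper hM UT tphi dL) => //.
    by have [hL' _ _] := hL; exact: hom_comp (hom_comp hE hL') ht.
  by move=> d' _ dL' W WU x; rewrite -[LHS]tEK// dL'.
move=> N NE dN psi L hN _ tpsi _ ML NL.
have [[hphi [s hs [sphi phis]]] _] := tphi.
have [[hpsi [u hu [upsi psiu]]] _] := tpsi.
pose f W (m : M W) := u W (phi W m).
have fE : eq_over U (fun W m => psi W (f W m)) phi by move=> W WU m; exact: psiu.
have hf : is_iso U f.
  split; first exact: hom_comp hphi hu.
  exists (fun W n => s W (psi W n)); first exact: hom_comp hpsi hs.
  by split=> W WU x; rewrite /f ?psiu ?sphi// phis ?upsi.
have UU : U `<=o` U by [].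
have ff := framed_iso_triv hM hN UT UU tphi tpsi hf fE.
exists f; split=> //; first exact: (intertwines_triv tphi tpsi hf fE ML NL).
move=> f' ff' W WU m.
by rewrite -[LHS]upsi// (framed_iso_unique hV hN UU tphi tpsi ff').
Qed.
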